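(* Let $V=[k]\times[k]$ and let $f:2^V\to\mathbb{R}_{\ge0}$ be a row-column-type non-negative monotone submodular function. Then for all $\gamma>0$ and all sufficiently large $n\in\mathbb{Z}_+$, there exist a non-negative monotone submodular function $\hat f:2^{[n]\times V}\to\mathbb{R}_{\ge0}$ and pairwise disjoint terminal sets $T_1,\dots,T_k\subseteq[n]\times V$ such that every algorithm that achieves an approximation factor of $\mathrm{SymGap}(f)-\gamma$ for the problem $$\min\Big\{\sum_{i=1}^k\hat f(V_i): V_1,\dots,V_k \text{ is a partition of } [n]\times V \text{ with } T_i\subseteq V_i\ \forall i\in[k]\Big\}$$ (with $\hat f$ accessed through an evaluation oracle) requires $2^{\Omega(n)}$ function evaluation queries.
   Context: For $i\in[k]$, $R_i=\{(i,j):j\in[k]\}$, $C_i=\{(j,i):j\in[k]\}$. $f$ is row-column-type if there is $g:2^V\to\mathbb{R}_{\ge0}$ with $f(A)=\sum_{i=1}^k\big(g(A\cap R_i)+g(A\cap C_i)\big)$ for all $A$. For $A\subseteq V$, $A^T=\{(j,i):(i,j)\in A\}$; a partition $V_1,\dots,V_k$ of $V$ is symmetric if $V_\ell=V_\ell^T$ for all $\ell$. $\mathrm{OPT}(f)=\min\{\sum_i f(V_i): V_1,\dots,V_k$ partition of $V$ with $(i,i)\in V_i\ \forall i\}$, $\mathrm{OPT}_{Sym}(f)$ is this minimum over symmetric partitions, and $\mathrm{SymGap}(f)=\mathrm{OPT}_{Sym}(f)/\mathrm{OPT}(f)$.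
   Formalization: Row-column-type is taken with g invariant under transposition, g(A^T)=g(A) (equivalently f(A^T)=f(A)); for arbitrary g the claim fails, e.g. k=2, f(A)=#{i: A meets R_i}+|A| has SymGap 7/6 although k=2 is solved exactly by submodular minimization. *)

(* Defs.v *)
From mathcomp Require Import all_boot all_order all_algebra.
From mathcomp Require Import all_classical all_reals all_analysis.

Set Implicit Arguments.
Unset Strict Implicit.
Unset Printing Implicit Defensive.

Import Order.TTheory GRing.Theory Num.Theory.
Local Open Scope ring_scope.
Local Open Scope classical_set_scope.

Section SetFunctions.
Context {R : realType} {U : finType}.
Implicit Type f : {set U} -> R.

Definition nonnegative f := forall A, 0 <= f A.

Definition monotone f := forall A B : {set U}, A \subset B -> f A <= f B.

Definition submodular f :=
  forall A B : {set U}, f (A :|: B)%SET + f (A :&: B)%SET <= f A + f B.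

Definition monotone_submodular f :=
  [/\ nonnegative f, monotone f & submodular f].

End SetFunctions.

Section MultiwayPartition.
Context {R : realType} {U : finType} {k : nat}.

Definition pairwise_disjoint (P : 'I_k -> {set U}) :=
  forall i j, i != j -> (P i :&: P j = finset.set0)%SET.

(* Parts may be empty. *)
Definition is_partition (P : 'I_k -> {set U}) :=
  pairwise_disjoint P /\ (forall x, exists i, x \in P i).

Definition feasible (T P : 'I_k -> {set U}) :=
  is_partition P /\ (forall i, T i \subset P i).

Definition cost (f : {set U} -> R) (P : 'I_k -> {set U}) : R :=
  \sum_(i < k) f (P i).

(* The infimum ranges over finitely many values, so it is a minimum as soon as
   a feasible partition exists (0 < k and T pairwise disjoint). *)
Definition multiway_opt (f : {set U} -> R) (T : 'I_k -> {set U}) : R :=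
  inf [set cost f P | P in [set P : {ffun 'I_k -> {set U}} | feasible T P]].

End MultiwayPartition.

Section Grid.
Context {R : realType} {k : nat}.
Implicit Type A : {set 'I_k * 'I_k}.

Definition grid_row (i : 'I_k) : {set 'I_k * 'I_k} := [set x | x.1 == i]%SET.
Definition grid_col (i : 'I_k) : {set 'I_k * 'I_k} := [set x | x.2 == i]%SET.

Definition transpose A : {set 'I_k * 'I_k} := [set x | (x.2, x.1) \in A]%SET.

(* The same g serves rows and columns, a column being read as a row through
   transposition: g is transposition-invariant, so that f is too, as the
   symmetry gap presupposes.  For an unrestricted g the hardness statement is
   false: k = 2 and f A = #|{i | A meets row i}| + #|A| would have symmetry
   gap 7/6, whereas for k = 2 the partition problem is a submodular
   minimization, solved exactly with polynomially many queries. *)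
Definition row_column_type (f : {set 'I_k * 'I_k} -> R) :=
  exists g : {set 'I_k * 'I_k} -> R,
    [/\ nonnegative g,
        forall A, g (transpose A) = g A &
        forall A, f A = \sum_(i < k) (g (A :&: grid_row i)%SET +
                                      g (A :&: grid_col i)%SET)].

Definition diag_terminals (i : 'I_k) : {set 'I_k * 'I_k} := [set (i, i)]%SET.

Definition symmetric_family (P : 'I_k -> {set 'I_k * 'I_k}) :=
  forall l, P l = transpose (P l).

Definition OPT (f : {set 'I_k * 'I_k} -> R) : R :=
  multiway_opt f diag_terminals.

Definition OPT_Sym (f : {set 'I_k * 'I_k} -> R) : R :=
  inf [set cost f P | P in [set P : {ffun 'I_k -> {set 'I_k * 'I_k}} |
                              feasible diag_terminals P /\ symmetric_family P]].

(* OPT f = 0 only for f = 0; the quotient is then 0 by convention. *)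
Definition SymGap (f : {set 'I_k * 'I_k} -> R) : R := OPT_Sym f / OPT f.

End Grid.

(* A deterministic oracle algorithm with unlimited computing power between
   queries: the next query, or the output, depends on the answers so far. *)
Inductive oracle_alg (R : realType) (U : finType) (O : Type) : Type :=
| Output of O
| Query of {set U} & (R -> oracle_alg R U O).

Section Algorithms.
Context {R : realType} {U : finType}.

Fixpoint run {O : Type} (a : oracle_alg R U O) (h : {set U} -> R) : O :=
  match a with
  | Output o => o
  | Query A next => run (next (h A)) h
  end.

Fixpoint num_queries {O : Type} (a : oracle_alg R U O) (h : {set U} -> R) : nat :=
  match a with
  | Output _ => 0%N
  | Query A next => (num_queries (next (h A)) h).+1
  end.

(* A randomized algorithm is a random deterministic one (a seed w drawn from
   Pr).  It has to succeed with probability at least p on every monotone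
   submodular oracle h: a guarantee for one fixed oracle would be met by an
   algorithm that has the solution hard-coded. The deterministic case is that
   of a constant [alg]. *)
Definition achieves_factor {k : nat} {d : measure_display}
    {Omega : measurableType d} (Pr : probability Omega R)
    (alg : Omega -> oracle_alg R U {ffun 'I_k -> {set U}})
    (T : 'I_k -> {set U}) (alpha p : R) :=
  forall h : {set U} -> R, monotone_submodular h ->
    (forall o, measurable [set w | run (alg w) h = o]) /\
    (p%:E <= Pr [set w | feasible T (run (alg w) h) /\
                         (cost h (run (alg w) h) <= alpha * multiway_opt h T)%R])%E.

End Algorithms.

(* Main.v *)
Require Import Defs.
From mathcomp Require Import all_boot all_order all_algebra.
From mathcomp Require Import all_classical all_reals all_analysis.
From mathcomp Require Import measurable_realfun ring lra.
Import Order.TTheory GRing.Theory Num.Theory.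
Local Open Scope ring_scope.
Set Implicit Arguments.
Unset Strict Implicit.
Unset Printing Implicit Defensive.

(** Each of the n layers of the blown-up grid is secretly transposed or not, as
    told by a string s.  A set S then has a density vector x in [0,1]^V, read in
    the untwisted coordinates; let x^T be its transposition and z = (x - x^T)/2.
    With F the multilinear extension of f, G(x) = F((x + x^T)/2) does not depend
    on s, while F has an optimum close to OPT f.  Since F - G and its gradient are
    O(|z|^2) and O(|z|), one can interpolate from G (where |z|^2 is below a
    constant del) to almost F by a cutoff that is linear in log |z|^2: all the
    error terms in the second differences are then so small that adding a little
    of a strictly concave function of |S| restores submodularity.  For a random s
    any fixed set has |z|^2 <= del but with exponentially small probability, so
    that few queries only reveal G.  Finally a feasible partition costs at least
    OPT_Sym f under G: round it at random, once for each pair {(i,j), (j,i)};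
    as a row or a column never contains both, the expected cost of a
    row-column-type f is the same as under independent rounding. *)

(** * Set functions *)

Section SetFunctionTheory.
Context {R : realType} {U : finType}.
Implicit Types (f g : {set U} -> R) (A B S : {set U}).

Lemma monotone_local f :
  (forall S a, a \notin S -> f S <= f (a |: S)%SET) -> Defs.monotone f.
Proof.
move=> H A B; move: {2}#|B :\: A|%SET (leqnn #|B :\: A|%SET) => m.
elim: m A B => [|m IH] A B.
  rewrite leqn0 cards_eq0 finset.setD_eq0 => BA AB.
  by have -> : A = B by apply/eqP; rewrite finset.eqEsubset AB.
move=> hm AB; have [/eqP|/finset.set0Pn [a]] := eqVneq (B :\: A)%SET finset.set0.
  rewrite finset.setD_eq0 => BA.
  by have -> : A = B by apply/eqP; rewrite finset.eqEsubset AB.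
rewrite inE => /andP[aA aB].
apply: le_trans (H A a aA) _; apply: IH.
  have -> : (B :\: (a |: A) = (B :\: A) :\ a)%SET.
    by apply/finset.setP => x; rewrite !inE negb_or andbA.
  by rewrite -ltnS; move: hm; rewrite (cardsD1 a) inE aA aB add1n.
by rewrite finset.subUset finset.sub1set aB.
Qed.

(** Two inductions: the local inequality first gives diminishing returns along any inclusion
    [A \subset B], and then the elements of [A :\: B] are added back one at a time. *)
Lemma submodular_local f :
  (forall S a b, a \notin S -> b \notin S -> a != b ->
     f (a |: (b |: S))%SET + f S <= f (a |: S)%SET + f (b |: S)%SET) ->
  Defs.submodular f.
Proof.
move=> H.
have step A B a : A \subset B -> a \notin B ->
    f (a |: B)%SET + f A <= f (a |: A)%SET + f B.
  move: {2}#|B :\: A|%SET (leqnn #|B :\: A|%SET) => m.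
  elim: m A B => [|m IH] A B hm AB aB.
    move: hm; rewrite leqn0 cards_eq0 finset.setD_eq0 => BA.
    by have -> : A = B by apply/eqP; rewrite finset.eqEsubset AB.
  have [/eqP|/finset.set0Pn [b]] := eqVneq (B :\: A)%SET finset.set0.
    rewrite finset.setD_eq0 => BA.
    by have -> : A = B by apply/eqP; rewrite finset.eqEsubset AB.
  rewrite inE => /andP[bA bB].
  have ab : a != b by apply: contraNneq aB => ->.
  have aA : a \notin A by apply: contraNN aB; apply: fintype.subsetP.
  have h1 := H A a b aA bA ab.
  have h2 : f (a |: B)%SET + f (b |: A)%SET <= f (a |: (b |: A))%SET + f B.
    apply: IH => //.
      have -> : (B :\: (b |: A) = (B :\: A) :\ b)%SET.
        by apply/finset.setP => x; rewrite !inE negb_or andbA.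
      by rewrite -ltnS; move: hm; rewrite (cardsD1 b) inE bA bB add1n.
    by rewrite finset.subUset finset.sub1set bB.
  lra.
move=> A B.
move: {2}#|A :\: B|%SET (leqnn #|A :\: B|%SET) => m.
elim: m A B => [|m IH] A B hm.
  move: hm; rewrite leqn0 cards_eq0 finset.setD_eq0 => AB.
  by rewrite (finset.setUidPr AB) (finset.setIidPl AB) addrC.
have [/eqP|/finset.set0Pn [a]] := eqVneq (A :\: B)%SET finset.set0.
  rewrite finset.setD_eq0 => AB.
  by rewrite (finset.setUidPr AB) (finset.setIidPl AB) addrC.
rewrite inE => /andP[aB aA].
pose A' := (A :\ a)%SET.
have AE : A = (a |: A')%SET by rewrite finset.setD1K.
have aA' : a \notin A' by rewrite !inE eqxx.
have h1 : f (A' :|: B)%SET + f (A' :&: B)%SET <= f A' + f B.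
  apply: IH.
  have -> : (A' :\: B = (A :\: B) :\ a)%SET.
    by apply/finset.setP => x; rewrite !inE andbCA.
  by rewrite -ltnS; move: hm; rewrite (cardsD1 a) inE aA aB add1n.
have h2 : f (a |: (A' :|: B))%SET + f A' <= f (a |: A')%SET + f (A' :|: B)%SET.
  by apply: step; rewrite ?finset.subsetUl // !inE eqxx (negbTE aB).
have -> : (A :|: B = a |: (A' :|: B))%SET by rewrite AE finset.setUA.
have -> : (A :&: B = A' :&: B)%SET.
  apply/finset.setP => x; rewrite !inE; case: eqVneq => // ->.
  by rewrite (negbTE aB) andbF.
rewrite -AE in h2; lra.
Qed.

Lemma monotone_submodular_sum (I : finType) (F : I -> {set U} -> R) :
  (forall i, monotone_submodular (F i)) ->
  monotone_submodular (fun S => \sum_i F i S).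
Proof.
move=> H; split.
- by move=> A; apply: sumr_ge0 => i _; case: (H i).
- by move=> A B AB; apply: ler_sum => i _; case: (H i) => _ /(_ A B AB).
- move=> A B; rewrite -!big_split /=; apply: ler_sum => i _.
  by case: (H i) => _ _ /(_ A B).
Qed.

Lemma monotone_submodularZ (c : R) f : 0 <= c ->
  monotone_submodular f -> monotone_submodular (fun S => c * f S).
Proof.
move=> c0 [f0 fm fs]; split.
- by move=> A; apply: mulr_ge0.
- by move=> A B AB; apply: ler_wpM2l => //; apply: fm.
- by move=> A B; rewrite -!mulrDr; apply: ler_wpM2l.
Qed.

Lemma monotone_submodular_preim (W : finType) (h : U -> W) f :
  monotone_submodular f ->
  monotone_submodular (fun S : {set W} => f [set u | h u \in S]%SET).
Proof.
move=> [f0 fm fs]; split.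
- by move=> A.
- by move=> A B /fintype.subsetP AB; apply: fm; apply/fintype.subsetP => x;
    rewrite !inE; apply: AB.
- move=> A B; apply: le_trans (fs _ _).
  by apply: lerD; rewrite le_eqVlt; apply/orP; left; apply/eqP;
    congr f; apply/finset.setP => x; rewrite !inE.
Qed.

Lemma monotone_submodular_cst (c : R) : 0 <= c ->
  monotone_submodular (fun _ : {set U} => c).
Proof. by move=> c0; split=> *. Qed.

End SetFunctionTheory.

(** * A logarithmic cutoff *)

Section LogCutoff.
Context {R : realType} (del : R) (del_gt0 : 0 < del).
Implicit Types s t : R.

Definition clip t := Num.max t del.
(* A C^1 function vanishing on [0, del] and growing like ln (t / del), such that
   t |logcut' t| <= 1 and t^2 |logcut'' t| = O(1). *)
Definition logcut t := ln (clip t / del) + del / clip t - 1.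
(** The derivative of [logcut]: it equals [1 / t - del / t ^+ 2] above [del] and 0 below. *)
Definition dlogcut t := (clip t - del) / (clip t) ^+ 2.

Lemma clip_ge t : t <= clip t. Proof. by rewrite /clip le_max lexx. Qed.
Lemma clip_gedel t : del <= clip t. Proof. by rewrite /clip le_max lexx orbT. Qed.
Lemma clip_gt0 t : 0 < clip t. Proof. exact: lt_le_trans del_gt0 (clip_gedel t). Qed.

Lemma ln_le_sub1 t : 0 < t -> ln t <= t - 1.
Proof.
by move=> t0; have := expR_ge1Dx (ln t); rewrite lnK ?posrE//; lra.
Qed.

Lemma ln_ge_1subV t : 0 < t -> 1 - t^-1 <= ln t.
Proof.
move=> t0; have := @ln_le_sub1 t^-1; rewrite invr_gt0 => /(_ t0).
by rewrite lnV ?posrE//; lra.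
Qed.

Lemma logcut_le0 t : t <= del -> logcut t = 0.
Proof.
move=> tdel; rewrite /logcut /clip max_r// divff ?gt_eqF// ln1; lra.
Qed.

Lemma logcut_ge0 t : 0 <= logcut t.
Proof.
have c0 := clip_gt0 t.
have := @ln_ge_1subV (clip t / del); rewrite divr_gt0// invf_div => /(_ isT).
by rewrite /logcut; lra.
Qed.

Lemma logcut_le m t : del <= m -> t <= m -> logcut t <= ln (m / del).
Proof.
move=> delm tm; have c0 := clip_gt0 t.
have h1 : del / clip t <= 1 by rewrite ler_pdivrMr// mul1r clip_gedel.
have h2 : ln (clip t / del) <= ln (m / del).
  rewrite ler_ln ?posrE ?divr_gt0//; last exact: lt_le_trans delm.
  by rewrite ler_pM2r ?invr_gt0// /clip ge_max tm.
by rewrite /logcut; lra.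
Qed.

(** The first factor is [ln (m / clip t) + 1 - del / clip t], which [ln x <= x - 1] bounds by
    [m / clip t]. So the cutoff falls far short of its maximum only where [t] is small. *)
Lemma logcut_defect m t : del <= m -> 0 <= t <= m ->
  (ln (m / del) - logcut t) * t <= m.
Proof.
move=> delm /andP[t0 tm]; have c0 := clip_gt0 t.
have m0 : 0 < m := lt_le_trans del_gt0 delm.
apply: (@le_trans _ _ ((ln (m / del) - logcut t) * clip t)).
  by rewrite ler_wpM2l ?clip_ge// subr_ge0 logcut_le.
have h : ln (m / del) - logcut t <= m / clip t.
  rewrite /logcut.
  have -> : m / del = (m / clip t) * (clip t / del).
    by field; rewrite !gt_eqF.
  rewrite lnM ?posrE ?divr_gt0//.
  have := @ln_le_sub1 (m / clip t); rewrite divr_gt0// => /(_ isT).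
  have : 0 < del / clip t by rewrite divr_gt0.
  lra.
by apply: le_trans (ler_wpM2r (ltW c0) h) _; rewrite divfK// gt_eqF.
Qed.

Lemma dlogcut_le t : 0 <= dlogcut t <= (clip t)^-1.
Proof.
have c0 := clip_gt0 t; have c1 := clip_gedel t.
rewrite /dlogcut divr_ge0 ?subr_ge0 ?sqr_ge0//=.
rewrite ler_pdivrMr ?exprn_gt0// expr2 mulKf ?gt_eqF//; by rewrite gerBl ltW.
Qed.

(** The clipped values are compared first, through [1 - 1 / x <= ln x <= x - 1] at their ratio;
    replacing them by [s] and [t] in the linear term costs one more square. *)
Lemma logcut_taylor s t : `|s - t| <= clip t / 2 ->
  `|logcut s - logcut t - dlogcut t * (s - t)| <= 3 * (s - t) ^+ 2 / (clip t) ^+ 2.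
Proof.
move=> hst.
have c0 := clip_gt0 t; have c1 := clip_gedel t.
have e0 := clip_gt0 s; have e1 := clip_gedel s.
set d := clip t in hst c0 c1 *; set e := clip s in e0 e1 *.
have e2 : d / 2 <= e.
  rewrite /e /d /clip; move: hst; rewrite /d /clip ler_norml => /andP[].
  by case: (leP t del); case: (leP s del) => *; lra.
have ed : (e - d) ^+ 2 <= (s - t) ^+ 2.
  rewrite -[leLHS]real_normK ?num_real// -[leRHS]real_normK ?num_real//.
  rewrite lerXn2r ?nnegrE// /e /d /clip.
  case: (ger0P (s - t)) => ?; case: (leP t del) => ?; case: (leP s del) => ?;
   rewrite ler_norml; apply/andP; split; lra.
have hA : `|logcut s - logcut t - dlogcut t * (e - d)| <= (e - d) ^+ 2 / (e * d).
  have -> : logcut s - logcut t - dlogcut t * (e - d) =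
     (ln (e / d) - (e - d) / d) + del * (e - d) ^+ 2 / (e * d ^+ 2).
    have lne : ln (e / del) = ln (e / d) + ln (d / del).
      by rewrite -lnM ?posrE ?divr_gt0//; congr ln; field; rewrite !gt_eqF.
    rewrite /logcut /dlogcut -/e -/d lne.
    by field; rewrite !gt_eqF.
  have u0 : 0 < e / d by rewrite divr_gt0.
  have l1 := ln_le_sub1 u0; have l2 := ln_ge_1subV u0.
  rewrite invf_div in l2.
  have q1 : 0 <= del * (e - d) ^+ 2 / (e * d ^+ 2).
    by apply: divr_ge0; apply: mulr_ge0; rewrite ?sqr_ge0// ltW.
  have q2 : del * (e - d) ^+ 2 / (e * d ^+ 2) <= (e - d) ^+ 2 / (e * d).
    rewrite -subr_ge0.
    have -> : (e - d) ^+ 2 / (e * d) - del * (e - d) ^+ 2 / (e * d ^+ 2) =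
       (d - del) * ((e - d) ^+ 2 / (e * d ^+ 2)) by field; rewrite !gt_eqF.
    apply: mulr_ge0; first by rewrite subr_ge0.
    by apply: divr_ge0; rewrite ?sqr_ge0//; apply: mulr_ge0; rewrite ?sqr_ge0// ltW.
  have q3 : (e - d) / d = e / d - 1 by field; rewrite !gt_eqF.
  have q4 : (e - d) ^+ 2 / (e * d) = e / d - 2 + d / e.
    by field; rewrite !gt_eqF.
  rewrite ler_norml; apply/andP; split; lra.
have hB : (e - d) ^+ 2 / (e * d) <= 2 * (s - t) ^+ 2 / d ^+ 2.
  rewrite ler_pdivrMr ?mulr_gt0//.
  have -> : 2 * (s - t) ^+ 2 / d ^+ 2 * (e * d) = (s - t) ^+ 2 * (2 * e / d).
    by field; rewrite !gt_eqF.
  apply: le_trans ed _; rewrite ler_peMr ?sqr_ge0//.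
  rewrite ler_pdivlMr//; lra.
(* The slope vanishes when [t <= del], and nothing changes when both points exceed [del]; when
   [s <= del < t], both [t - del] and [del - s] are at most [t - s]. *)
have hC : `|dlogcut t * (e - d) - dlogcut t * (s - t)| <= (s - t) ^+ 2 / d ^+ 2.
  rewrite -mulrBr /dlogcut -/d mulrAC normrM (ger0_norm (_ : 0 <= (d ^+ 2)^-1));
    last by rewrite invr_ge0 sqr_ge0.
  rewrite ler_wpM2r ?invr_ge0 ?sqr_ge0//.
  rewrite /e /d /clip; case: (leP t del) => ht.
    by rewrite subrr mul0r normr0 sqr_ge0.
  case: (leP s del) => hs; last by rewrite subrr mulr0 normr0 sqr_ge0.
  have -> : del - t - (s - t) = del - s by ring.
  rewrite ger0_norm; last by apply: mulr_ge0; lra.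
  have -> : (s - t) ^+ 2 = (t - s) * (t - s) by ring.
  by apply: ler_pM; lra.
have := ler_normD (logcut s - logcut t - dlogcut t * (e - d))
   (dlogcut t * (e - d) - dlogcut t * (s - t)).
have -> : logcut s - logcut t - dlogcut t * (e - d) +
   (dlogcut t * (e - d) - dlogcut t * (s - t)) =
   logcut s - logcut t - dlogcut t * (s - t) by ring.
have -> : 3 * (s - t) ^+ 2 / d ^+ 2 =
   2 * (s - t) ^+ 2 / d ^+ 2 + (s - t) ^+ 2 / d ^+ 2 by ring.
lra.
Qed.

Lemma logcut_lip s t : `|s - t| <= clip t / 2 ->
  `|logcut s - logcut t| <= 3 * `|s - t| / clip t.
Proof.
move=> hst; have c0 := clip_gt0 t.
have := logcut_taylor hst; have /andP[l0 l1] := dlogcut_le t.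
set d := clip t in hst c0 l1 *; move=> h.
have h1 : `|dlogcut t * (s - t)| <= `|s - t| / d.
  by rewrite normrM ger0_norm// mulrC ler_wpM2l.
have h2 : 3 * (s - t) ^+ 2 / d ^+ 2 <= 2 * `|s - t| / d.
  have -> : 3 * (s - t) ^+ 2 / d ^+ 2 = `|s - t| / d * (3 * (`|s - t| / d)).
    by rewrite -[in LHS](real_normK (num_real (s - t))); field; rewrite gt_eqF.
  have : `|s - t| / d <= 2^-1 by rewrite ler_pdivrMr// mulrC.
  have : 0 <= `|s - t| / d by rewrite divr_ge0// ltW.
  rewrite -!mulrA; nra.
have := ler_normD (logcut s - logcut t - dlogcut t * (s - t)) (dlogcut t * (s - t)).
rewrite subrK; have -> : 3 * `|s - t| / d = 2 * `|s - t| / d + `|s - t| / d by ring.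
lra.
Qed.

End LogCutoff.

(** * Multilinear extensions near the symmetric points *)

Section ProductEstimates.
Context {R : realType} {I : Type}.
Implicit Types (r : seq I) (a b y z : I -> R).

Lemma norm_prod_le1 r a : (forall v, `|a v| <= 1) -> `|\prod_(v <- r) a v| <= 1.
Proof.
move=> h; rewrite normr_prod; elim: r => [|v r IH]; first by rewrite big_nil.
by rewrite big_cons mulr_ile1 // prodr_ge0.
Qed.

Lemma prod_lip r a b : (forall v, `|a v| <= 1) -> (forall v, `|b v| <= 1) ->
  `|\prod_(v <- r) a v - \prod_(v <- r) b v| <= \sum_(v <- r) `|a v - b v|.
Proof.
move=> ha hb; elim: r => [|v r IH]; first by rewrite !big_nil subrr normr0.
rewrite !big_cons; set P := \prod_(_ <- r) a _ in IH *.
have hP : `|P| <= 1 by exact: norm_prod_le1.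
set Q := \prod_(_ <- r) b _ in IH *.
have -> : a v * P - b v * Q = (a v - b v) * P + b v * (P - Q) by ring.
apply: le_trans (ler_normD _ _) _; rewrite !normrM; apply: lerD.
  by rewrite ler_piMr.
by apply: le_trans IH; rewrite ler_piMl.
Qed.

(** The second central difference of the product at [y] in direction [z]. It is even in [z], hence
    of order two. *)
Definition symprod r y z :=
  \prod_(v <- r) (y v + z v) + \prod_(v <- r) (y v - z v)
  - 2 * \prod_(v <- r) y v.

Definition unit_pair y z :=
  (forall v, `|y v + z v| <= 1) /\ (forall v, `|y v - z v| <= 1).

Lemma unit_pairW y z : unit_pair y z ->
  (forall v, `|y v| <= 1) /\ (forall v, `|z v| <= 1).
Proof.
move=> [h1 h2]; split=> v; move: (h1 v) (h2 v); rewrite !ler_norml;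
 move=> /andP[? ?] /andP[? ?]; apply/andP; split; lra.
Qed.

Lemma symprod_cons v r y z : symprod (v :: r) y z =
  y v * symprod r y z +
  z v * (\prod_(v <- r) (y v + z v) - \prod_(v <- r) (y v - z v)).
Proof. by rewrite /symprod !big_cons; ring. Qed.

Lemma antiprod_le r y z : unit_pair y z ->
  `|\prod_(v <- r) (y v + z v) - \prod_(v <- r) (y v - z v)| <=
  2 * \sum_(v <- r) `|z v|.
Proof.
move=> [h1 h2]; apply: le_trans (prod_lip _ h1 h2) _.
rewrite mulr_sumr ler_sum// => v _.
have -> : y v + z v - (y v - z v) = 2 * z v by ring.
by rewrite normrM ger0_norm.
Qed.

Lemma symprod_le r y z : unit_pair y z ->
  `|symprod r y z| <= (\sum_(v <- r) `|z v|) ^+ 2.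
Proof.
move=> hyz; have [hy hz] := unit_pairW hyz.
elim: r => [|v r IH].
  by rewrite /symprod !big_nil expr0n/= (_ : 1 + 1 - 2 * 1 = 0) ?normr0//; ring.
rewrite symprod_cons big_cons; have hP := antiprod_le r hyz.
set P := _ - _ in hP *; set s := \sum_(_ <- r) _ in IH hP *.
apply: le_trans (ler_normD _ _) _; rewrite !normrM.
have h1 : `|y v| * `|symprod r y z| <= s ^+ 2.
  by apply: le_trans IH; rewrite ler_piMl.
have h2 : `|z v| * `|P| <= `|z v| * (2 * s) by rewrite ler_wpM2l.
have : 0 <= `|z v| ^+ 2 by rewrite sqr_ge0.
have -> : (`|z v| + s) ^+ 2 = `|z v| ^+ 2 + `|z v| * (2 * s) + s ^+ 2 by ring.
lra.
Qed.

Lemma antiprod_diff r y z y' z' : unit_pair y z -> unit_pair y' z' ->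
  `|(\prod_(v <- r) (y' v + z' v) - \prod_(v <- r) (y' v - z' v)) -
    (\prod_(v <- r) (y v + z v) - \prod_(v <- r) (y v - z v))| <=
  2 * \sum_(v <- r) (`|y' v - y v| + `|z' v - z v|).
Proof.
move=> [h1 h2] [h1' h2'].
have k1 := prod_lip r h1' h1; have k2 := prod_lip r h2' h2.
have l1 : \sum_(v <- r) `|y' v + z' v - (y v + z v)| <=
    \sum_(v <- r) (`|y' v - y v| + `|z' v - z v|).
  apply: ler_sum => v _; apply: le_trans (ler_normD _ _).
  by rewrite le_eqVlt; apply/orP; left; apply/eqP; congr `|_|; ring.
have l2 : \sum_(v <- r) `|y' v - z' v - (y v - z v)| <=
    \sum_(v <- r) (`|y' v - y v| + `|z' v - z v|).
  apply: ler_sum => v _; apply: le_trans (ler_normB _ _).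
  by rewrite le_eqVlt; apply/orP; left; apply/eqP; congr `|_|; ring.
set a := \prod_(v <- r) (y' v + z' v) in k1 *.
set b := \prod_(v <- r) (y' v - z' v) in k2 *.
set c := \prod_(v <- r) (y v + z v) in k1 *.
set d := \prod_(v <- r) (y v - z v) in k2 *.
have := ler_normB (a - c) (b - d).
have -> : a - c - (b - d) = a - b - (c - d) by ring.
lra.
Qed.

(** A gradient bound: since [symprod] is quadratic in the direction, a displacement [eta] changes it
    by only [O(eta * s)]. The induction follows [symprod_cons]. *)
Lemma symprod_diff r y z y' z' : unit_pair y z -> unit_pair y' z' ->
  let eta := \sum_(v <- r) (`|y' v - y v| + `|z' v - z v|) in
  let s := \sum_(v <- r) (`|z v| + `|z' v|) in
  `|symprod r y' z' - symprod r y z| <= eta * s * (4 + s).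
Proof.
move=> hyz hyz' /=; have [hy hz] := unit_pairW hyz.
have [hy' hz'] := unit_pairW hyz'.
elim: r => [|v r IH].
  by rewrite /symprod !big_nil subrr normr0 !mul0r.
rewrite !symprod_cons !big_cons.
have hR := antiprod_diff r hyz hyz'.
have hP := antiprod_le r hyz.
have hQ := symprod_le r hyz.
set eta := \sum_(_ <- r) (`|y' _ - _| + _) in IH hR *.
set s := \sum_(_ <- r) (`|z _| + _) in IH *.
have zs : \sum_(v <- r) `|z v| <= s by apply: ler_sum => w _; rewrite lerDl.
have z0 : 0 <= \sum_(v <- r) `|z v| by apply: sumr_ge0.
have eta0 : 0 <= eta by apply: sumr_ge0 => *; rewrite addr_ge0.
have s0 : 0 <= s by exact: le_trans zs.
set Q' := symprod r y' z' in IH *; set Q := symprod r y z in IH hQ *.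
set P := _ - _ in hP hR *.
set P' := (X in z' v * X) in hR *.
have -> : y' v * Q' + z' v * P' - (y v * Q + z v * P) =
  y' v * (Q' - Q) + (y' v - y v) * Q + (z' v * (P' - P) + (z' v - z v) * P) by ring.
apply: le_trans (ler_normD _ _) _.
have := ler_normD (y' v * (Q' - Q)) ((y' v - y v) * Q).
have := ler_normD (z' v * (P' - P)) ((z' v - z v) * P).
rewrite !normrM.
have t1 : `|y' v| * `|Q' - Q| <= eta * s * (4 + s).
  by apply: le_trans IH; rewrite ler_piMl.
have t2 : `|y' v - y v| * `|Q| <= `|y' v - y v| * (s * s).
  rewrite ler_wpM2l//; apply: le_trans hQ _; rewrite expr2.
  by apply: ler_pM.
have t3 : `|z' v| * `|P' - P| <= `|z' v| * (2 * eta) by rewrite ler_wpM2l.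
have t4 : `|z' v - z v| * `|P| <= `|z' v - z v| * (2 * s).
  by rewrite ler_wpM2l//; lra.
move: (normr_ge0 (y' v - y v)) (normr_ge0 (z' v - z v)) (normr_ge0 (z v)) (normr_ge0 (z' v)).
move: t1 t2 t3 t4.
set A1 := `|y' v - y v|; set A2 := `|z' v - z v|; set B1 := `|z v|; set B2 := `|z' v|.
move=> t1 t2 t3 t4 A10 A20 B10 B20 u1 u2.
(* The bound for [v :: r] is expanded into the four bounds [t1] to [t4] and a remainder, all of
   whose terms are nonnegative. *)
have p1 : (A1 + A2 + eta) * (B1 + B2 + s) * (4 + (B1 + B2 + s)) =
   eta * s * (4 + s) + A1 * (s * s) + B2 * (2 * eta) + A2 * (2 * s)
   + (A1 * 4 * s + A2 * (2 * s + s * s)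
     + eta * (4 * B1 + 2 * B2 + s * (B1 + B2) + (B1 + B2) * (B1 + B2 + s))
     + (A1 + A2) * ((B1 + B2) * (4 + B1 + B2 + s) + s * (B1 + B2))) by ring.
have p2 : 0 <= A1 * 4 * s + A2 * (2 * s + s * s)
     + eta * (4 * B1 + 2 * B2 + s * (B1 + B2) + (B1 + B2) * (B1 + B2 + s))
     + (A1 + A2) * ((B1 + B2) * (4 + B1 + B2 + s) + s * (B1 + B2)).
  by rewrite !(addr_ge0, mulr_ge0).
rewrite p1; lra.
Qed.

End ProductEstimates.

(** * Multilinear extensions at a point and at its symmetrisation *)

Section MultilinearExtension.
Context {R : realType} {V : finType}.
Implicit Types (f : {set V} -> R) (x : V -> R).

Definition mle f x : R :=
  \sum_(A : {set V}) f A * \prod_v (if v \in A then x v else 1 - x v).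

Lemma eq_mle f x x' : x =1 x' -> mle f x = mle f x'.
Proof.
by move=> e; apply: eq_bigr => A _; congr (_ * _); apply: eq_bigr => v _; rewrite e.
Qed.

(** For a uniform [th] the events [rho v (th v) \in S] are independent, so the random argument of
    [f] contains each [v] independently with the stated frequency. *)
Lemma mean_sample (W T : finType) (rho : V -> T -> W) f (S : {set W}) :
  (0 < #|T|)%N ->
  (#|{ffun V -> T}|%:R)^-1 *
    \sum_(th : {ffun V -> T}) f [set v | rho v (th v) \in S]%SET =
  mle f (fun v => #|[set t | rho v t \in S]%SET|%:R / #|T|%:R).
Proof.
move=> T0; have T0' : (#|T|%:R : R) != 0 by rewrite pnatr_eq0 -lt0n.
pose pr (A : {set V}) (th : {ffun V -> T}) := [forall v, (rho v (th v) \in S) == (v \in A)].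
(* The samples are grouped by the set [A] that they produce; the indicator of producing [A] is a
   product over [v], so its sum over [th] factorizes. *)
have -> : \sum_(th : {ffun V -> T}) f [set v | rho v (th v) \in S]%SET =
   \sum_(A : {set V}) f A * \sum_(th : {ffun V -> T}) \prod_v
       ((rho v (th v) \in S) == (v \in A))%:R.
  under [RHS]eq_bigr do rewrite mulr_sumr.
  rewrite exchange_big /=; apply: eq_bigr => th _.
  set A0 := [set v | _]%SET; rewrite (bigD1 A0)//= [X in _ + X]big1 ?addr0.
    by rewrite big1 ?mulr1// => v _; rewrite inE eqxx.
  move=> A AA0.
  have [v hv] : exists v, (v \in A0) != (v \in A).
    apply/existsP; apply: contraR AA0; rewrite negb_exists => /forallP h.
    by apply/eqP/finset.setP => v; move: (h v); rewrite negbK => /eqP ->.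
  by rewrite (bigD1 v)//=; move: hv; rewrite inE => /negbTE ->; rewrite mul0r mulr0.
rewrite mulr_sumr; apply: eq_bigr => A _; rewrite mulrCA; congr (_ * _).
rewrite -(bigA_distr_bigA (fun v t => ((rho v t \in S) == (v \in A))%:R)) /=.
rewrite card_ffun natrX -exprVn.
rewrite -prodr_const -big_split /=; apply: eq_bigr => v _.
have -> : \sum_(i : T) ((rho v i \in S) == (v \in A))%:R =
   #|[set t | (rho v t \in S) == (v \in A)]%SET|%:R :> R.
  by rewrite -sum1_card natr_sum [RHS]big_mkcond /=; apply: eq_bigr => t _; rewrite inE;
   case: (_ == _).
case: ifP => vA.
  by rewrite mulrC; congr (_%:R / _); apply: eq_card => t; rewrite !inE eqb_id.
have -> : [set t | (rho v t \in S) == false]%SET = (~: [set t | rho v t \in S])%SET.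
  by apply/finset.setP => t; rewrite !inE eqbF_neg.
rewrite finset.cardsCs finset.setCK natrB ?max_card//.
by rewrite mulrC mulrBl divff.
Qed.

Context (tr : V -> V) (trK : involutive tr).
Context (f : {set V} -> R) (f_ge0 : forall A, 0 <= f A)
  (f_tr : forall A : {set V}, f (tr @^-1: A)%SET = f A).

Lemma mle_tr x : mle f (x \o tr) = mle f x.
Proof.
have inj : injective (fun A : {set V} => tr @^-1: A)%SET.
  apply: (can_inj (g := fun A : {set V} => tr @^-1: A)%SET) => A.
  by apply/finset.setP => v; rewrite !inE trK.
rewrite /mle (reindex_inj inj) /=; apply: eq_bigr => A _.
rewrite f_tr; congr (_ * _); rewrite (reindex_inj (can_inj trK)) /=.
by apply: eq_bigr => v _; rewrite inE trK.
Qed.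

Definition sympart x v := (x v + x (tr v)) / 2.
Definition antipart x v := (x v - x (tr v)) / 2.

(** The factor of [v] in the term of [A] is [yA + zA] at [x], [yA - zA] at [x \o tr], and [yA] at
    [sympart x]. *)
Let yA x (A : {set V}) v := if v \in A then sympart x v else 1 - sympart x v.
Let zA x (A : {set V}) v := if v \in A then antipart x v else - antipart x v.

(** By invariance [mle f x] is the mean of its values at [x] and [x \o tr]; the first-order terms in
    the antisymmetric part cancel. *)
Lemma mle_sympart x :
  mle f x - mle f (sympart x) =
  2^-1 * \sum_(A : {set V}) f A * symprod (index_enum V) (yA x A) (zA x A).
Proof.
have e1 : mle f x = \sum_(A : {set V}) f A * \prod_v (yA x A v + zA x A v).
  apply: eq_bigr => A _; congr (_ * _); apply: eq_bigr => v _.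
  by rewrite /yA /zA /sympart /antipart; case: ifP => _; field.
have e2 : mle f x = \sum_(A : {set V}) f A * \prod_v (yA x A v - zA x A v).
  rewrite -[LHS]mle_tr.
  apply: eq_bigr => A _; congr (_ * _); apply: eq_bigr => v _.
  by rewrite /yA /zA /sympart /antipart /=; case: ifP => _; field.
have e3 : mle f (sympart x) = \sum_(A : {set V}) f A * \prod_v (yA x A v).
  by [].
under eq_bigr do rewrite /symprod mulrBr mulrDr [f _ * (2 * _)]mulrCA.
by rewrite sumrB big_split /= -mulr_sumr -e1 -e2 -e3; field.
Qed.

Lemma yzA_unit x A : (forall v, 0 <= x v <= 1) -> unit_pair (yA x A) (zA x A).
Proof.
move=> hx; split=> v; rewrite /yA /zA /sympart /antipart ler_norml;
  move: (hx v) (hx (tr v)) => /andP[? ?] /andP[? ?]; case: ifP => _;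
  apply/andP; split; lra.
Qed.

Lemma norm_zA x A v : `|zA x A v| = `|antipart x v|.
Proof. by rewrite /zA; case: ifP => // _; rewrite normrN. Qed.

Lemma mle_defect x : (forall v, 0 <= x v <= 1) ->
  `|mle f x - mle f (sympart x)| <=
  (\sum_A f A) * (\sum_v `|antipart x v|) ^+ 2.
Proof.
move=> hx; rewrite mle_sympart normrM.
have h : `|\sum_(A : {set V}) f A * symprod (index_enum V) (yA x A) (zA x A)| <=
  (\sum_A f A) * (\sum_v `|antipart x v|) ^+ 2.
  apply: le_trans (ler_norm_sum _ _ _) _; rewrite mulr_suml; apply: ler_sum => A _.
  rewrite normrM ger0_norm// ler_wpM2l//.
  apply: le_trans (symprod_le _ (yzA_unit A hx)) _.
  by under eq_bigr do rewrite norm_zA.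
by apply: le_trans h; rewrite ler_piMl// ger0_norm; lra.
Qed.

Lemma mle_defect_diff x x' :
  (forall v, 0 <= x v <= 1) -> (forall v, 0 <= x' v <= 1) ->
  let eta := \sum_v (`|sympart x' v - sympart x v| + `|antipart x' v - antipart x v|) in
  let s := \sum_v (`|antipart x v| + `|antipart x' v|) in
  `|(mle f x' - mle f (sympart x')) - (mle f x - mle f (sympart x))| <=
  (\sum_A f A) * (eta * s * (4 + s)).
Proof.
move=> hx hx'; cbv zeta; set eta := (X in X * _ * _).
set s := (X in _ * X * (4 + _)); rewrite !mle_sympart -mulrBr -sumrB normrM.
set X := \sum_(_ : {set V}) (_ - _).
have h : `|X| <= (\sum_A f A) * (eta * s * (4 + s)).
  apply: le_trans (ler_norm_sum _ _ _) _; rewrite mulr_suml; apply: ler_sum => A _.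
  rewrite -mulrBr normrM ger0_norm// ler_wpM2l//.
  apply: le_trans (symprod_diff _ (yzA_unit A hx) (yzA_unit A hx')) _.
  rewrite le_eqVlt; apply/orP; left; apply/eqP.
  have -> : \sum_v (`|yA x' A v - yA x A v| + `|zA x' A v - zA x A v|) = eta.
    apply: eq_bigr => v _; congr (_ + _); rewrite /yA /zA; case: ifP => // _.
      by rewrite distrC; congr `|_|; ring.
    by rewrite distrC; congr `|_|; ring.
  by under eq_bigr do rewrite !norm_zA.
by apply: le_trans h; rewrite ler_piMl// ger0_norm; lra.
Qed.

End MultilinearExtension.

(** * Interpolation of submodular functions *)

Section Interpolation.
Context {R : realType} {W : finType}.
Context (F G D J : {set W} -> R) (h del Dm K Lam eps : R).
Context (F_ms : monotone_submodular F) (G_ms : monotone_submodular G).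
Context (h_gt0 : 0 < h) (del_gt0 : 0 < del) (Dm_ge1 : 1 <= Dm) (del_le : del <= Dm)
  (K_ge1 : 1 <= K) (eps_ge0 : 0 <= eps).
Context (D_bnd : forall S, 0 <= D S <= Dm).
Context (H_bnd : forall S, `|F S - G S| <= K * D S).
Context (H_lip : forall (S : {set W}) a (r : R), a \notin S -> 0 <= r -> D S <= r * r ->
  `|(F (a |: S)%SET - G (a |: S)%SET) - (F S - G S)| <= K * h * (r + h)).
Context (D_lip : forall (S : {set W}) a (r : R), a \notin S -> 0 <= r -> D S <= r * r ->
  `|D (a |: S)%SET - D S| <= K * h * (r + h)).
Context (D_diff2 : forall (S : {set W}) a b, a \notin S -> b \notin S -> a != b ->
  `|D (a |: (b |: S))%SET - D (a |: S)%SET - D (b |: S)%SET + D S| <= K * h * h).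
Context (J_ge0 : forall S, 0 <= J S).
Context (J_incr : forall (S : {set W}) a, a \notin S -> Dm * h <= J (a |: S)%SET - J S).
Context (J_diff2 : forall (S : {set W}) a b, a \notin S -> b \notin S -> a != b ->
  J (a |: (b |: S))%SET - J (a |: S)%SET - J (b |: S)%SET + J S <= - (h * h)).
Context (h_small : (10 * K * h) ^+ 2 <= del).
Context (Lam_def : Lam = ln (Dm / del)).
Context (Lam_gt0 : 0 < Lam).
Context (Lam_big : 300 * K ^+ 3 <= Lam * eps).

(** In the hypotheses, [h] is the size of a one-element step, [D] a squared distance to the region
    where [F] and [G] agree, and [r] any bound on the square root of [D S]. The weight of [F] is 0
    for [D S <= del] and at most 1; the term in [J] pays for the variation of the weight. *)
Definition interp S := G S + logcut del (D S) / Lam * (F S - G S) + eps * J S.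

Local Notation L := (logcut del).

Lemma interp_weight S : 0 <= L (D S) / Lam <= 1.
Proof.
have /andP[d0 d1] := D_bnd S.
rewrite divr_ge0 ?logcut_ge0 ?(ltW Lam_gt0)//= ler_pdivrMr// mul1r Lam_def.
exact: logcut_le.
Qed.

(** Where the weight is far from 1, [D S] and hence [F S - G S] is small; [logcut_defect] bounds the
    product uniformly. *)
Lemma interp_close S : `|interp S - (F S + eps * J S)| <= K * Dm / Lam.
Proof.
have -> : interp S - (F S + eps * J S) = - ((Lam - L (D S)) / Lam * (F S - G S)).
  by rewrite /interp; field; rewrite gt_eqF.
have /andP[w0 w1] := interp_weight S.
have d := D_bnd S; have /andP[d0 d1] := d.
have lam : 0 <= (Lam - L (D S)) / Lam.
  by rewrite divr_ge0 ?(ltW Lam_gt0)// subr_ge0 Lam_def logcut_le.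
rewrite normrN normrM ger0_norm//.
apply: le_trans (ler_wpM2l lam (H_bnd S)) _.
have -> : (Lam - L (D S)) / Lam * (K * D S) = K * ((Lam - L (D S)) * D S) / Lam by ring.
rewrite ler_pM2r ?invr_gt0// ler_pM2l ?(lt_le_trans ltr01)// Lam_def.
exact: logcut_defect.
Qed.

Lemma interp_near S : D S <= del -> interp S = G S + eps * J S.
Proof. by move=> hD; rewrite /interp logcut_le0// mul0r mul0r addr0. Qed.

Section Point.
Context (S : {set W}).
(** The local scale at [S]. Clipping keeps [r] at least [10 * K * h], so that one or two added
    elements change [D] by at most [d / 2], the range in which the estimates for [logcut] apply. *)
Let d := clip del (D S).
Let r := Num.sqrt d.

Let d_gt0 : 0 < d. Proof. exact: clip_gt0. Qed.
Let r_gt0 : 0 < r. Proof. by rewrite sqrtr_gt0. Qed.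
Let rr : d = r * r. Proof. by rewrite -expr2 sqr_sqrtr// ltW. Qed.
Let D_le_d : D S <= r * r. Proof. by rewrite -rr clip_ge. Qed.
Let K_gt0 : 0 < K. Proof. exact: lt_le_trans K_ge1. Qed.

Let h_le_r : 10 * K * h <= r.
Proof.
have p : 0 <= 10 * K * h by rewrite !mulr_ge0// ltW.
rewrite -(ler_pXn2r (isT : (0 < 2)%N)) ?nnegrE//; last exact: ltW.
by apply: le_trans h_small _; rewrite expr2 -rr clip_gedel.
Qed.

Let h_le_r1 : h <= r.
Proof.
apply: le_trans h_le_r; rewrite ler_peMl ?(ltW h_gt0)//.
by have := K_ge1; lra.
Qed.

Let Khr_le : 10 * (K * h * r) <= d.
Proof.
have -> : 10 * (K * h * r) = 10 * K * h * r by ring.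
by rewrite rr ler_pM2r.
Qed.

Let Kh_gt0 : 0 < K * h. Proof. exact: mulr_gt0. Qed.

Let stepD a : a \notin S -> `|D (a |: S)%SET - D S| <= 2 * (K * h * r).
Proof.
move=> aS; apply: le_trans (D_lip aS (ltW r_gt0) D_le_d) _.
have -> : 2 * (K * h * r) = K * h * (r + r) by ring.
by rewrite ler_pM2l// lerD2l.
Qed.

Let stepL a : a \notin S -> `|L (D (a |: S)%SET) - L (D S)| <= 6 * K * h / r.
Proof.
move=> aS; have hs := stepD aS.
have p : 0 <= K * h * r by rewrite mulr_ge0// ltW.
have hd : `|D (a |: S)%SET - D S| <= d / 2 by have := Khr_le; lra.
apply: le_trans (logcut_lip del_gt0 hd) _.
rewrite -/d ler_pdivrMr// rr.
have -> : 6 * K * h / r * (r * r) = 3 * (2 * (K * h * r)) by field; rewrite gt_eqF.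
by rewrite ler_pM2l.
Qed.

Let D1_le a : a \notin S -> D (a |: S)%SET <= (2 * r) * (2 * r).
Proof.
move=> aS; have := stepD aS; rewrite ler_norml => /andP[_ u].
have -> : 2 * r * (2 * r) = 4 * d by rewrite rr; ring.
have := D_le_d; rewrite -rr; have := Khr_le; have := d_gt0; lra.
Qed.

(** Discrete product rule: the increment is a convex combination of those of [F] and [G], plus the
    change of weight times [F - G]. The latter is [O(K ^+ 2 * Dm * h / Lam)] and is outweighed by
    the growth of [eps * J]. *)
Lemma interp_incr a : a \notin S -> interp S <= interp (a |: S)%SET.
Proof.
move=> aS; have /andP[w0 w1] := interp_weight S.
have [_ Fm _] := F_ms; have [_ Gm _] := G_ms.
have hF := Fm _ _ (finset.subsetUr [set a]%SET S).
have hG := Gm _ _ (finset.subsetUr [set a]%SET S).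
have hL := stepL aS.
have hH := H_bnd (a |: S)%SET.
have hD : D (a |: S)%SET <= 2 * d.
  have := stepD aS; rewrite ler_norml => /andP[_ u].
  have := D_le_d; rewrite -rr; have := Khr_le; have := d_gt0; lra.
(* Here [r ^+ 2 = d <= Dm <= Dm ^+ 2], the last step because [1 <= Dm]. *)
have rDm : r <= Dm.
  rewrite -(ler_pXn2r (isT : (0 < 2)%N)) ?nnegrE//; last 2 first.
    exact: ltW. by apply: le_trans Dm_ge1.
  rewrite expr2 -rr; apply: (@le_trans _ _ Dm).
    by rewrite /d /clip ge_max del_le andbT; case/andP: (D_bnd S).
  by rewrite expr2 ler_peMr// (le_trans _ Dm_ge1).
set u := (L (D (a |: S)%SET) - L (D S)) * (F (a |: S)%SET - G (a |: S)%SET).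
have hu : `|u| <= 12 * K ^+ 2 * (Dm * h).
  rewrite normrM.
  apply: (@le_trans _ _ (6 * K * h / r * (K * (2 * d)))).
    apply: ler_pM => //; apply: le_trans hH _; by rewrite ler_pM2l.
  have -> : 6 * K * h / r * (K * (2 * d)) = 12 * K ^+ 2 * (h * r).
    by rewrite rr; field; rewrite gt_eqF.
  rewrite ler_pM2l ?mulr_gt0 ?exprn_gt0//.
  by rewrite mulrC ler_pM2r.
have hJ := J_incr aS.
have e : interp (a |: S)%SET - interp S =
   (1 - L (D S) / Lam) * (G (a |: S)%SET - G S) + L (D S) / Lam * (F (a |: S)%SET - F S)
   + (u / Lam + eps * (J (a |: S)%SET - J S)).
  by rewrite /interp /u; field; rewrite gt_eqF.
rewrite -subr_ge0 e; apply: addr_ge0.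
  by apply: addr_ge0; apply: mulr_ge0; rewrite ?subr_ge0.
have hJ' : eps * (Dm * h) <= eps * (J (a |: S)%SET - J S) by rewrite ler_wpM2l.
have k3 : 12 * K ^+ 2 <= Lam * eps.
  apply: le_trans Lam_big; rewrite [K ^+ 3]exprS.
  have : K ^+ 2 <= K * K ^+ 2 by rewrite ler_peMl// exprn_ge0// ltW.
  have : 0 <= K * K ^+ 2 by rewrite mulr_ge0 ?exprn_ge0 // ltW.
  lra.
have : - (eps * (Dm * h)) <= u / Lam.
  rewrite ler_pdivlMr// mulNr; move: hu; rewrite ler_norml => /andP[hu _].
  apply: le_trans hu; rewrite lerN2.
  have -> : eps * (Dm * h) * Lam = (Lam * eps) * (Dm * h) by ring.
  by rewrite ler_pM2r// mulr_gt0// (lt_le_trans _ Dm_ge1).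
lra.
Qed.

(** The weighted second differences of [F] and [G] have the right sign. In each error term the
    powers of [1 / r] from the cutoff cancel against those of [r] from [F - G], leaving
    [O(K ^+ 3 * h ^+ 2 / Lam)] independently of [d]; the strict concavity of [eps * J] absorbs
    it. *)
Lemma interp_diff2 a b : a \notin S -> b \notin S -> a != b ->
  interp (a |: (b |: S))%SET + interp S <= interp (a |: S)%SET + interp (b |: S)%SET.
Proof.
move=> aS bS ab; have /andP[w0 w1] := interp_weight S.
have abS : a \notin (b |: S)%SET by rewrite !inE negb_or ab.
have baS : b \notin (a |: S)%SET by rewrite !inE negb_or eq_sym ab.
have cm : (b |: (a |: S) = a |: (b |: S))%SET by rewrite finset.setUCA.
have sub2 (f : {set W} -> R) : monotone_submodular f ->
    0 <= f (a |: S)%SET + f (b |: S)%SET - f (a |: (b |: S))%SET - f S.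
  move=> [_ _ /(_ (a |: S)%SET (b |: S)%SET)].
  have -> : ((a |: S) :|: (b |: S) = a |: (b |: S))%SET.
    by apply/finset.setP => x; rewrite !inE; case: (x == a); case: (x == b); case: (x \in S).
  have -> : ((a |: S) :&: (b |: S) = S)%SET.
    apply/finset.setP => x; rewrite !inE; case: (eqVneq x a) => [->|_] /=.
      by rewrite (negbTE ab).
    by case: (x == b); case: (x \in S).
  lra.
have hF := sub2 _ F_ms; have hG := sub2 _ G_ms.
have hJ := J_diff2 aS bS ab.
have sDa := stepD aS; have sDb := stepD bS; have sD2 := D_diff2 aS bS ab.
have p : 0 < K * h * r by rewrite mulr_gt0.
have Khh : K * h * h <= K * h * r by rewrite ler_pM2l.
have sDab : `|D (a |: (b |: S))%SET - D S| <= 5 * (K * h * r).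
  move: sDa sDb sD2; rewrite !ler_norml => /andP[? ?] /andP[? ?] /andP[? ?].
  apply/andP; split; lra.
have dK := Khr_le.
have hDab : D (a |: (b |: S))%SET <= 2 * d.
  move: sDab; rewrite ler_norml => /andP[_ u].
  have := D_le_d; rewrite -rr; have := d_gt0; lra.
have Ta := logcut_taylor del_gt0 (_ : `|D (a |: S)%SET - D S| <= d / 2).
have Tb := logcut_taylor del_gt0 (_ : `|D (b |: S)%SET - D S| <= d / 2).
have Tab := logcut_taylor del_gt0 (_ : `|D (a |: (b |: S))%SET - D S| <= d / 2).
have {}Ta := Ta ltac:(lra).
have {}Tb := Tb ltac:(lra).
have {}Tab := Tab ltac:(lra).
rewrite -/d in Ta Tb Tab.
have sqb (x c : R) : `|x| <= c * (K * h * r) -> 3 * x ^+ 2 / d ^+ 2 <= 3 * c ^+ 2 * (K ^+ 2 * h ^+ 2 / d).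
  move=> hx; have hx2 : x ^+ 2 <= (c * (K * h * r)) ^+ 2.
    by rewrite -[leLHS]real_normK ?num_real// lerXn2r ?nnegrE// (le_trans _ hx).
  have -> : 3 * c ^+ 2 * (K ^+ 2 * h ^+ 2 / d) = 3 * ((c * (K * h * r)) ^+ 2 / d ^+ 2).
    by rewrite rr; field; rewrite gt_eqF.
  by rewrite -mulrA ler_pM2l// ler_pM2r// invr_gt0 exprn_gt0.
have Ea := sqb _ _ sDa; have Eb := sqb _ _ sDb; have Eab := sqb _ _ sDab.
have /andP[l0 l1] := dlogcut_le del_gt0 (D S); rewrite -/d in l1.
set la := L (D (a |: S)%SET) in Ta *. set lb := L (D (b |: S)%SET) in Tb *.
set lab := L (D (a |: (b |: S))%SET) in Tab *. set l := L (D S) in w0 w1 Ta Tb Tab *.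
set ld := dlogcut del (D S) in l0 l1 Ta Tb Tab.
have El : `|ld * (D (a |: (b |: S))%SET - D (a |: S)%SET - D (b |: S)%SET + D S)|
    <= K * h ^+ 2 / d.
  rewrite normrM ger0_norm// mulrC [h ^+ 2]expr2 mulrA.
  by apply: ler_pM.
have KK : K * h ^+ 2 / d <= K ^+ 2 * h ^+ 2 / d.
  by rewrite ler_pM2r ?invr_gt0// ler_pM2r ?exprn_gt0// expr2 ler_peMr// ltW.
set q := K ^+ 2 * h ^+ 2 / d in KK Ea Eb Eab.
(* The Taylor remainders contribute 75 + 12 + 12, from steps of size 5, 2 and 2 times [K * h * r],
   and the linear part [El] contributes 1. *)
have Ll : `|lab - la - lb + l| <= 100 * q.
  move: Ta Tb Tab El; rewrite !ler_norml => /andP[? ?] /andP[? ?] /andP[? ?] /andP[? ?].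
  apply/andP; split; lra.
set Ha := F (a |: S)%SET - G (a |: S)%SET. set Hb := F (b |: S)%SET - G (b |: S)%SET.
set Hab := F (a |: (b |: S))%SET - G (a |: (b |: S))%SET.
have r2 : 0 <= 2 * r by rewrite mulr_ge0// ltW.
(* The Lipschitz bound is applied at [a |: S], where [D1_le] allows the radius [2 * r]. *)
have HHa : `|Hab - Ha| <= 3 * (K * h * r).
  have := H_lip baS r2 (D1_le aS); rewrite cm -/Hab -/Ha.
  move=> hh; apply: le_trans hh _.
  have -> : 3 * (K * h * r) = K * h * (2 * r + r) by ring.
  by rewrite ler_pM2l// lerD2l.
have HHb : `|Hab - Hb| <= 3 * (K * h * r).
  have := H_lip abS r2 (D1_le bS); rewrite -/Hab -/Hb.
  move=> hh; apply: le_trans hh _.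
  have -> : 3 * (K * h * r) = K * h * (2 * r + r) by ring.
  by rewrite ler_pM2l// lerD2l.
have hLa := stepL aS; have hLb := stepL bS.
rewrite -/la -/lb -/l in hLa hLb.
have E1 : `|(la - l) * (Hab - Ha)| <= 18 * (K ^+ 2 * h ^+ 2).
  have -> : 18 * (K ^+ 2 * h ^+ 2) = (6 * K * h / r) * (3 * (K * h * r)).
    by field; rewrite gt_eqF.
  by rewrite normrM; apply: ler_pM.
have E2 : `|(lb - l) * (Hab - Hb)| <= 18 * (K ^+ 2 * h ^+ 2).
  have -> : 18 * (K ^+ 2 * h ^+ 2) = (6 * K * h / r) * (3 * (K * h * r)).
    by field; rewrite gt_eqF.
  by rewrite normrM; apply: ler_pM.
have E3 : `|(lab - la - lb + l) * Hab| <= 200 * (K ^+ 3 * h ^+ 2).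
  have -> : 200 * (K ^+ 3 * h ^+ 2) = (100 * q) * (K * (2 * d)).
    by rewrite /q; field; rewrite gt_eqF.
  rewrite normrM; apply: ler_pM => //.
  by apply: le_trans (H_bnd _) _; rewrite ler_pM2l.
have E4 : K ^+ 2 * h ^+ 2 <= K ^+ 3 * h ^+ 2.
  by rewrite ler_pM2r ?exprn_gt0// [leRHS]exprS ler_peMl// exprn_ge0// ltW.
(* The error terms of the discrete Leibniz rule for the second difference of
   (L o D) * (F - G). *)
set u := (la - l) * (Hab - Ha) + (lb - l) * (Hab - Hb) + (lab - la - lb + l) * Hab.
have hu : u <= 300 * K ^+ 3 * h ^+ 2.
  have kp : 0 <= K ^+ 3 * h ^+ 2 by rewrite mulr_ge0 ?sqr_ge0 ?exprn_ge0// ltW.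
  move: E1 E2 E3; rewrite !ler_norml => /andP[_ ?] /andP[_ ?] /andP[_ ?].
  rewrite /u; lra.
have e : interp (a |: S)%SET + interp (b |: S)%SET
    - (interp (a |: (b |: S))%SET + interp S) =
  (1 - l / Lam) * (G (a |: S)%SET + G (b |: S)%SET - G (a |: (b |: S))%SET - G S)
  + l / Lam * (F (a |: S)%SET + F (b |: S)%SET - F (a |: (b |: S))%SET - F S)
  - (u / Lam + eps * (J (a |: (b |: S))%SET - J (a |: S)%SET - J (b |: S)%SET + J S)).
  rewrite /interp -/la -/lb -/lab -/l /u /Ha /Hb /Hab; field; by rewrite gt_eqF.
have w1' : 0 <= 1 - l / Lam by rewrite subr_ge0.
rewrite -subr_ge0 e; apply: addr_ge0.
  by apply: addr_ge0; apply: mulr_ge0.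
rewrite oppr_ge0.
have j1 : eps * (J (a |: (b |: S))%SET - J (a |: S)%SET - J (b |: S)%SET + J S)
   <= eps * - (h * h) by rewrite ler_wpM2l.
have j2 : u / Lam <= eps * (h * h).
  rewrite ler_pdivrMr//; apply: le_trans hu _.
  have -> : eps * (h * h) * Lam = (Lam * eps) * h ^+ 2 by ring.
  by rewrite ler_pM2r ?exprn_gt0.
lra.
Qed.

End Point.

Lemma interp_monotone_submodular : monotone_submodular interp.
Proof.
split.
- move=> S; have /andP[w0 w1] := interp_weight S.
  have [F0 _ _] := F_ms; have [G0 _ _] := G_ms.
  have -> : interp S = (1 - L (D S) / Lam) * G S + L (D S) / Lam * F S + eps * J S.
    by rewrite /interp; ring.
  by apply: addr_ge0; [apply: addr_ge0|]; apply: mulr_ge0; rewrite ?subr_ge0.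
- by apply: monotone_local => S a; exact: interp_incr.
- by apply: submodular_local => S a b; exact: interp_diff2.
Qed.

End Interpolation.

(** * The twisted blow-up of the grid *)

Section TwistedGrid.
Context {R : realType} {k : nat}.
Notation V := ('I_k * 'I_k)%type.

Definition swap (v : V) : V := (v.2, v.1).
Definition twist (b : bool) (v : V) : V := if b then swap v else v.

Lemma swapK : involutive swap. Proof. by case. Qed.
Lemma twistK b : involutive (twist b). Proof. by case: b => // -[]. Qed.
Lemma twist_swap b v : twist b (swap v) = twist (~~ b) v.
Proof. by case: b => //=; rewrite swapK. Qed.
Lemma twist_twist b c v : twist b (twist c v) = twist (b (+) c) v.
Proof. by case: b; case: c => //=; rewrite swapK. Qed.
Lemma twist_diag b (i : 'I_k) : twist b (i, i) = (i, i). Proof. by case: b. Qed.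

(** Transposition exchanges the row and the column of index [i], and [g] is invariant under it, so
    the two summands trade places. *)
Lemma row_column_type_swap (f : {set V} -> R) : row_column_type f ->
  forall A : {set V}, f (swap @^-1: A)%SET = f A.
Proof.
case=> g [_ g_tr fE] A; rewrite !fE; apply: eq_bigr => i _; rewrite addrC.
congr (_ + _).
  by rewrite -[RHS]g_tr; congr g; apply/finset.setP => v; rewrite !inE.
by rewrite -[RHS]g_tr; congr g; apply/finset.setP => v; rewrite !inE.
Qed.

(** * Densities on n layers, their asymmetry, and a strictly concave term *)

Section Instance.
Context {n : nat}.
Notation W := ('I_n * ('I_k * 'I_k))%type.
Implicit Types (s : {ffun 'I_n -> bool}) (S : {set W}).

(** [point_twisted] follows the secret string in the sampled layer, where [point_sym] reads the bit
    of the sample as a fair coin for the transposition. The common sample type makes both arguments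
    of [sample_mean]. *)
Definition point_twisted s (v : V) (t : 'I_n * bool) : W := (t.1, twist (s t.1) v).
Definition point_sym (v : V) (t : 'I_n * bool) : W := (t.1, twist t.2 v).

(* An average of pullbacks of f, hence monotone submodular like f; by
   mean_sample it is also the multilinear extension of f at a vector of densities. *)
Definition sample_mean (f : {set V} -> R) (rho : V -> 'I_n * bool -> W) S : R :=
  (#|{ffun V -> 'I_n * bool}|%:R)^-1 *
    \sum_(th : {ffun V -> 'I_n * bool}) f [set v | rho v (th v) \in S]%SET.

Lemma sample_mean_ms f rho : monotone_submodular f ->
  monotone_submodular (sample_mean f rho).
Proof.
move=> f_ms; apply: monotone_submodularZ; first by rewrite invr_ge0.
apply: monotone_submodular_sum => th.
exact: (monotone_submodular_preim (fun v => rho v (th v))).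
Qed.

Context (n_gt0 : (0 < n)%N).
Let h : R := n%:R^-1.

Let n_neq0 : n%:R != 0 :> R. Proof. by rewrite pnatr_eq0 -lt0n. Qed.
Let h_gt0 : 0 < h. Proof. by rewrite invr_gt0 ltr0n. Qed.

Definition density s S (v : V) : R :=
  n%:R^-1 * \sum_(i < n) ((i, twist (s i) v) \in S)%:R.

Lemma card_pair_bool (P : 'I_n -> bool -> bool) :
  #|[set t : 'I_n * bool | P t.1 t.2]%SET|%:R = \sum_(i < n) \sum_(b : bool) (P i b)%:R :> R.
Proof.
rewrite -sum1_card natr_sum pair_big /= big_mkcond /=; apply: eq_bigr => t _.
by rewrite inE; case: (P _ _).
Qed.

Lemma density_twisted s S v :
  #|[set t | point_twisted s v t \in S]%SET|%:R / #|{: 'I_n * bool}|%:R = density s S v.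
Proof.
rewrite (card_pair_bool (fun i _ => (i, twist (s i) v) \in S)).
rewrite card_prod card_ord card_bool natrM /density.
under eq_bigr do rewrite sumr_const card_bool.
by rewrite sumrMnl; field.
Qed.

(** In each layer the two values of the coin give [v] and [swap v] once each, whatever [s] is: the
    left-hand side does not mention [s]. *)
Lemma density_sym s S v :
  #|[set t | point_sym v t \in S]%SET|%:R / #|{: 'I_n * bool}|%:R =
  sympart swap (density s S) v.
Proof.
rewrite (card_pair_bool (fun i b => (i, twist b v) \in S)).
rewrite card_prod card_ord card_bool natrM /sympart /density.
rewrite -mulrDr -big_split /=.
have -> : \sum_(i < n) \sum_(b : bool) ((i, twist b v) \in S)%:R =
   \sum_(i < n) (((i, twist (s i) v) \in S)%:R + ((i, twist (s i) (swap v)) \in S)%:R) :> R.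
  apply: eq_bigr => i _; rewrite big_bool twist_swap.
  by case: (s i) => //=; rewrite addrC.
by field.
Qed.

Lemma sample_mean_twisted f s S :
  sample_mean f (point_twisted s) S = mle f (density s S).
Proof.
rewrite /sample_mean mean_sample; last by rewrite card_prod card_ord card_bool muln_gt0 n_gt0.
by apply: eq_mle => v; rewrite density_twisted.
Qed.

Lemma sample_mean_sym f s S :
  sample_mean f point_sym S = mle f (sympart swap (density s S)).
Proof.
rewrite /sample_mean mean_sample; last by rewrite card_prod card_ord card_bool muln_gt0 n_gt0.
by apply: eq_mle => v; rewrite -density_sym.
Qed.

Lemma density_unit s S v : 0 <= density s S v <= 1.
Proof.
rewrite /density mulr_ge0 ?invr_ge0 ?sumr_ge0//=.
rewrite ler_pdivrMl ?ltr0n// mulr1.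
apply: (@le_trans _ _ (\sum_(i < n) 1)); last by rewrite sumr_const card_ord.
by apply: ler_sum => i _; rewrite lern1 leq_b1.
Qed.

(** Equal to 1 if [a] is the copy of [v] in its own layer and to 0 otherwise: the change of [n]
    times the density of [v] when [a] is added. *)
Definition jump s (a : W) (v : V) : R := \sum_(i < n) ((i, twist (s i) v) == a)%:R.

Lemma jump_unit s a v : 0 <= jump s a v <= 1.
Proof.
rewrite sumr_ge0//= /jump (bigD1 a.1)//= [X in _ + X]big1 ?addr0 ?lern1 ?leq_b1//.
by move=> i ia; case: eqVneq => // e; move: ia; rewrite -e /= eqxx.
Qed.

Lemma densityU s S a v : a \notin S ->
  density s (a |: S)%SET v = density s S v + h * jump s a v.
Proof.
move=> aS; rewrite /density /jump -mulrDr -big_split /=; congr (_ * _).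
apply: eq_bigr => i _; rewrite !inE; case: eqVneq => [->|_] /=.
  by rewrite (negbTE aS) add0r.
by rewrite addr0.
Qed.

Let z s S := antipart swap (density s S).
Let dz s a v := h * ((jump s a v - jump s a (swap v)) / 2).

Lemma antipartU s S a v : a \notin S ->
  antipart swap (density s (a |: S)%SET) v =
  antipart swap (density s S) v + n%:R^-1 * ((jump s a v - jump s a (swap v)) / 2).
Proof. by move=> aS; rewrite /antipart !densityU// -/h; ring. Qed.

Lemma antipart_le1 s S v : `|antipart swap (density s S) v| <= 1.
Proof.
rewrite ler_norml /antipart; move: (density_unit s S v) (density_unit s S (swap v)).
by move=> /andP[? ?] /andP[? ?]; apply/andP; split; lra.
Qed.

Let dz_le s a v : `|dz s a v| <= h.
Proof.
rewrite /dz normrM (gtr0_norm h_gt0) ler_piMr ?(ltW h_gt0)// ler_norml.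
move: (jump_unit s a v) (jump_unit s a (swap v)).
by move=> /andP[? ?] /andP[? ?]; apply/andP; split; lra.
Qed.

Definition asym s S : R := \sum_v (antipart swap (density s S) v) ^+ 2.

Let N : R := #|{: V}|%:R.

Let sum_le_N (a : V -> R) c : (forall v, a v <= c) -> \sum_v a v <= N * c.
Proof.
move=> ha; apply: (@le_trans _ _ (\sum_(v : V) c)); first exact: ler_sum.
by rewrite sumr_const -mulr_natl.
Qed.

Lemma asym_bnd s S : 0 <= asym s S <= #|{: V}|%:R.
Proof.
rewrite sumr_ge0 /=; last by move=> *; rewrite sqr_ge0.
rewrite -/N -[N]mulr1; apply: sum_le_N => v; rewrite -real_normK ?num_real//.
by rewrite exprn_ile1// antipart_le1.
Qed.

Lemma antipart_le s S v (r : R) : 0 <= r -> asym s S <= r * r ->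
  `|antipart swap (density s S) v| <= r.
Proof.
move=> r0 hr; rewrite -(ler_pXn2r (isT : (0 < 2)%N)) ?nnegrE// real_normK ?num_real//.
rewrite [r ^+ 2]expr2; apply: le_trans hr; rewrite /asym (bigD1 v)//= lerDl.
by apply: sumr_ge0 => *; rewrite sqr_ge0.
Qed.

Lemma asym_lip s S a (r : R) : a \notin S -> 0 <= r -> asym s S <= r * r ->
  `|asym s (a |: S)%SET - asym s S| <= 2 * N * h * (r + h).
Proof.
move=> aS r0 hr; rewrite /asym -sumrB.
have -> : 2 * N * h * (r + h) = N * (2 * h * (r + h)) by ring.
apply: le_trans (ler_norm_sum _ _ _) _; apply: sum_le_N => v.
rewrite antipartU// -/(dz s a v); have hz := antipart_le v r0 hr.
set zz := antipart _ _ _ in hz *; have hd := dz_le s a v; set dd := dz s a v in hd *.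
have -> : (zz + dd) ^+ 2 - zz ^+ 2 = dd * (2 * zz + dd) by ring.
rewrite normrM; have -> : 2 * h * (r + h) = h * (2 * r + 2 * h) by ring.
apply: ler_pM => //; apply: le_trans (ler_normD _ _) _.
rewrite normrM ger0_norm//; have := h_gt0; lra.
Qed.

Lemma asym_diff2 s S a b : a \notin S -> b \notin S -> a != b ->
  `|asym s (a |: (b |: S))%SET - asym s (a |: S)%SET - asym s (b |: S)%SET + asym s S|
  <= 2 * N * h * h.
Proof.
move=> aS bS ab; have abS : a \notin (b |: S)%SET by rewrite !inE negb_or ab.
rewrite /asym -!sumrB -big_split /=.
have -> : 2 * N * h * h = N * (2 * (h * h)) by ring.
apply: le_trans (ler_norm_sum _ _ _) _; apply: sum_le_N => v.
rewrite !antipartU// -/(dz s a v) -/(dz s b v).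
set zz := antipart _ _ _.
have -> : (zz + dz s b v + dz s a v) ^+ 2 - (zz + dz s a v) ^+ 2 -
  (zz + dz s b v) ^+ 2 + zz ^+ 2 = 2 * (dz s a v * dz s b v) by ring.
by rewrite normrM ger0_norm// ler_pM2l// normrM; apply: ler_pM.
Qed.

Context (f : {set V} -> R) (f_ge0 : forall A, 0 <= f A)
  (f_swap : forall A : {set V}, f (swap @^-1: A)%SET = f A).

Let Mf := \sum_A f A.
Let Mf_ge0 : 0 <= Mf. Proof. exact: sumr_ge0. Qed.

(** Each antisymmetric coordinate is at most the square root of [asym s S], so their sum is at most
    [N] times it, and [mle_defect] squares this sum. *)
Lemma mean_defect s S :
  `|sample_mean f (point_twisted s) S - sample_mean f point_sym S| <=
  Mf * N ^+ 2 * asym s S.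
Proof.
rewrite sample_mean_twisted (sample_mean_sym _ s).
apply: le_trans (mle_defect swapK f_ge0 f_swap (density_unit s S)) _.
rewrite -mulrA ler_wpM2l// -[asym s S]sqr_sqrtr; last by case/andP: (asym_bnd s S).
rewrite -exprMn lerXn2r ?nnegrE ?sumr_ge0 ?mulr_ge0 ?sqrtr_ge0//.
apply: sum_le_N => v; apply: antipart_le; first exact: sqrtr_ge0.
by rewrite -expr2 sqr_sqrtr//; case/andP: (asym_bnd s S).
Qed.

Lemma mean_defect_lip s S a (r : R) : a \notin S -> 0 <= r -> asym s S <= r * r ->
  `|(sample_mean f (point_twisted s) (a |: S)%SET - sample_mean f point_sym (a |: S)%SET)
    - (sample_mean f (point_twisted s) S - sample_mean f point_sym S)| <=
  8 * Mf * N ^+ 2 * (2 + N) * h * (r + h).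
Proof.
move=> aS r0 hr; rewrite !sample_mean_twisted !(sample_mean_sym _ s).
apply: le_trans (mle_defect_diff swapK f_ge0 f_swap (density_unit s S)
  (density_unit s (a |: S)%SET)) _.
set eta := (X in _ * (X * _ * _)); set t := (X in _ * (_ * X * (4 + _))).
have eta_le : eta <= N * (h + h).
  apply: sum_le_N => v; apply: lerD.
    rewrite /sympart !densityU//.
    have -> : (density s S v + h * jump s a v + (density s S (swap v) + h * jump s a (swap v))) / 2
       - (density s S v + density s S (swap v)) / 2 =
       h * ((jump s a v + jump s a (swap v)) / 2) by ring.
    rewrite normrM (gtr0_norm h_gt0) ler_piMr ?(ltW h_gt0)// ler_norml.
    move: (jump_unit s a v) (jump_unit s a (swap v)).
    by move=> /andP[? ?] /andP[? ?]; apply/andP; split; lra.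
  by rewrite antipartU// addrC addKr; exact: dz_le.
have eta0 : 0 <= eta by apply: sumr_ge0 => *; rewrite addr_ge0.
have t0 : 0 <= t by apply: sumr_ge0 => *; rewrite addr_ge0.
have t_le : t <= N * (2 * (r + h)).
  apply: sum_le_N => v; have hz := antipart_le v r0 hr.
  rewrite antipartU// -/(dz s a v).
  have := ler_normD (antipart swap (density s S) v) (dz s a v).
  have := dz_le s a v; have := h_gt0; lra.
(* The small bound [t_le] serves the factor [t], this absolute one the factor [4 + t]. *)
have t_le2 : t <= N * 2.
  apply: sum_le_N => v; have := antipart_le1 s S v.
  have := antipart_le1 s (a |: S)%SET v; lra.
have -> : 8 * Mf * N ^+ 2 * (2 + N) * h * (r + h) =
  Mf * ((N * (h + h)) * (N * (2 * (r + h))) * (4 + N * 2)) by ring.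
rewrite ler_wpM2l//; apply: ler_pM; rewrite ?mulr_ge0 ?addr_ge0//.
  exact: ler_pM.
by rewrite lerD2l.
Qed.

(** With [u = #|S| / n <= N] this is [u * (4 * N - u)]: the slope in [u] stays at least [2 * N], and
    second differences equal [- 2 / n ^+ 2]. *)
Definition concave_cost S : R :=
  #|S|%:R / n%:R * (4 * #|{: V}|%:R - #|S|%:R / n%:R).

Let u_le S : #|S|%:R * h <= N.
Proof.
rewrite ler_pdivrMr ?ltr0n// -natrM ler_nat; apply: leq_trans (max_card _) _.
by rewrite card_prod card_ord mulnC.
Qed.

Let u_ge0 S : 0 <= #|S|%:R * h. Proof. by rewrite mulr_ge0// ltW. Qed.

Lemma concave_cost_ge0 S : 0 <= concave_cost S.
Proof. by rewrite /concave_cost -/h -/N mulr_ge0 ?u_ge0//; have := u_le S; have := u_ge0 S; lra. Qed.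

Lemma concave_cost_le S : concave_cost S <= 4 * #|{: V}|%:R ^+ 2.
Proof.
rewrite /concave_cost -/h -/N; have a1 := u_le S; have a0 := u_ge0 S.
have -> : 4 * N ^+ 2 = N * (4 * N) by ring.
apply: ler_pM => //; lra.
Qed.

Lemma concave_cost_incr S a : a \notin S ->
  #|{: V}|%:R * n%:R^-1 <= concave_cost (a |: S)%SET - concave_cost S.
Proof.
move=> aS; rewrite /concave_cost -/h -/N.
have := u_le (a |: S)%SET; rewrite cardsU1 aS /= natrD mulrDl mul1r.
have := u_ge0 S; set u := #|S|%:R * h => u0 u1.
have -> : (h + u) * (4 * N - (h + u)) - u * (4 * N - u) = (4 * N - 2 * u - h) * h by ring.
by rewrite ler_pM2r//; have := h_gt0; lra.
Qed.

Lemma concave_cost_diff2 S a b : a \notin S -> b \notin S -> a != b ->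
  concave_cost (a |: (b |: S))%SET - concave_cost (a |: S)%SET - concave_cost (b |: S)%SET
   + concave_cost S <= - (n%:R^-1 * n%:R^-1).
Proof.
move=> aS bS ab; have abS : a \notin (b |: S)%SET by rewrite !inE negb_or ab.
rewrite /concave_cost -/h -/N !cardsU1 abS aS bS /= !natrD.
set u := #|S|%:R.
have -> : (1 + (1 + u)) * h * (4 * N - (1 + (1 + u)) * h) -
 (1 + u) * h * (4 * N - (1 + u) * h) - (1 + u) * h * (4 * N - (1 + u) * h) +
 u * h * (4 * N - u * h) = - (2 * (h * h)) by ring.
have : 0 <= h * h by rewrite mulr_ge0// ltW.
lra.
Qed.

End Instance.

(** [g] is shared by all [s], and [del] is fixed before [n], so that the probability of
    [asym s S > del] decays at a rate independent of [n]. *)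
Lemma hard_family (f : {set V} -> R) (eta : R) : (0 < k)%N ->
  monotone_submodular f -> row_column_type f -> 0 < eta ->
  exists2 del : R, 0 < del & exists n0 : nat, forall n, (n0 <= n)%N -> (0 < n)%N /\
  exists (g : {set 'I_n * V} -> R) (F : {ffun 'I_n -> bool} -> {set 'I_n * V} -> R),
  [/\ monotone_submodular g, forall s, monotone_submodular (F s),
      forall S, sample_mean f point_sym S <= g S,
      forall s S, F s S <= sample_mean f (point_twisted s) S + eta &
      forall s S, asym s S <= del -> F s S = g S].
Proof.
move=> k0 f_ms f_rc eta0; have [f_ge0 _ _] := f_ms.
have f_swap := row_column_type_swap f_rc.
pose N : R := #|{: V}|%:R; pose Mf := \sum_A f A.
have N1 : 1 <= N by rewrite ler1n card_prod card_ord muln_gt0 k0.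
have N0 : 0 < N by exact: lt_le_trans N1.
have Mf0 : 0 <= Mf by exact: sumr_ge0.
pose c := 8 * Mf * N ^+ 2 * (2 + N).
have c0 : 0 <= c by rewrite !mulr_ge0 ?exprn_ge0 ?addr_ge0// ltW.
pose K := 1 + 2 * N + c.
have K1 : 1 <= K by rewrite /K; lra.
have K0 : 0 < K by exact: lt_le_trans K1.
(* Since [J <= 4 * N ^+ 2], the concave term costs at most [eta / 2]. *)
pose eps := eta / (8 * N ^+ 2).
have eps0 : 0 < eps by rewrite divr_gt0// mulr_gt0// exprn_gt0.
(* The second summand makes the errors absorbable by [eps * J]; the third keeps [K * N / Lam], the
   distance in [interp_close], below [eta / 2]. *)
pose Lam := 1 + 300 * K ^+ 3 / eps + 2 * K * N / eta.
have p1 : 0 < 300 * K ^+ 3 / eps by rewrite divr_gt0// mulr_gt0// exprn_gt0.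
have p2 : 0 < 2 * K * N / eta by rewrite divr_gt0// !mulr_gt0.
have Lam0 : 0 < Lam by rewrite /Lam; lra.
pose del := N * expR (- Lam).
have del0 : 0 < del by rewrite mulr_gt0// expR_gt0.
have del_le : del <= N.
  by rewrite ler_piMr ?(ltW N0)// -expR0 ler_expR; lra.
have Lam_def : Lam = ln (N / del).
  rewrite /del (_ : N / (N * expR (- Lam)) = expR Lam) ?expRK//.
  by rewrite expRN; field; rewrite !gt_eqF// expR_gt0.
have Lam_big : 300 * K ^+ 3 <= Lam * eps.
  rewrite -ler_pdivrMr//; rewrite /Lam; lra.
have Lam_big2 : K * N / Lam <= eta / 2.
  rewrite ler_pdivrMr// mulrAC ler_pdivlMr// mulrC -ler_pdivrMl//.
  by rewrite /Lam mulrC mulrA; lra.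
(* Beyond this threshold [10 * K / n] is at most the square root of [del]; the successor makes [n]
   positive. *)
exists del => //; exists (Num.bound ((10 * K) ^+ 2 / del)).+1 => n hn.
have n0 : (0 < n)%N by exact: leq_trans hn.
split=> //; pose h : R := n%:R^-1.
have nR0 : 0 < n%:R :> R by rewrite ltr0n.
have h0 : 0 < h by rewrite invr_gt0.
have h_small : (10 * K * h) ^+ 2 <= del.
  rewrite exprMn /h exprVn ler_pdivrMr ?exprn_gt0// -ler_pdivrMl// mulrC.
  have h1 : (10 * K) ^+ 2 / del <= n%:R.
    have q : 0 <= (10 * K) ^+ 2 / del by rewrite divr_ge0 ?sqr_ge0// ltW.
    apply: ltW; apply: lt_le_trans (archi_boundP q) _.
    by rewrite ler_nat ltnW.
  by apply: le_trans h1 _; rewrite expr2 ler_peMl ?ler1n// ltW.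
pose G : {set 'I_n * V} -> R := sample_mean f point_sym.
pose Fm s : {set 'I_n * V} -> R := sample_mean f (point_twisted s).
pose J : {set 'I_n * V} -> R := concave_cost.
have G_ms : monotone_submodular G by exact: sample_mean_ms.
have Fm_ms s : monotone_submodular (Fm s) by exact: sample_mean_ms.
have H_bnd s (S : {set 'I_n * V}) : `|Fm s S - G S| <= K * asym s S.
  apply: le_trans (mean_defect n0 f_ge0 f_swap s S) _.
  rewrite ler_wpM2r//; first by case/andP: (asym_bnd n0 s S).
  have q : Mf * N ^+ 2 <= c.
    have -> : c = Mf * N ^+ 2 * (8 * (2 + N)) by rewrite /c; ring.
    by rewrite ler_peMr ?mulr_ge0 ?exprn_ge0 ?(ltW N0)//; lra.
  by rewrite /K -/Mf -/N; lra.
have H_lip s (S : {set 'I_n * V}) a (r : R) : a \notin S -> 0 <= r -> asym s S <= r * r ->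
    `|(Fm s (a |: S)%SET - G (a |: S)%SET) - (Fm s S - G S)| <= K * h * (r + h).
  move=> aS r0 hr; apply: le_trans (mean_defect_lip n0 f_ge0 f_swap aS r0 hr) _.
  rewrite ler_wpM2r ?addr_ge0 ?(ltW h0)// ler_wpM2r ?(ltW h0)// -/Mf -/N -/c.
  by rewrite /K; lra.
have D_lip s (S : {set 'I_n * V}) a (r : R) : a \notin S -> 0 <= r -> asym s S <= r * r ->
    `|asym s (a |: S)%SET - asym s S| <= K * h * (r + h).
  move=> aS r0 hr; apply: le_trans (asym_lip n0 aS r0 hr) _.
  rewrite ler_wpM2r ?addr_ge0 ?(ltW h0)// ler_wpM2r ?(ltW h0)// -/N.
  by rewrite /K; lra.
have D_diff2 s (S : {set 'I_n * V}) a b : a \notin S -> b \notin S -> a != b ->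
    `|asym s (a |: (b |: S))%SET - asym s (a |: S)%SET - asym s (b |: S)%SET + asym s S|
    <= K * h * h.
  move=> aS bS ab; apply: le_trans (asym_diff2 n0 s aS bS ab) _.
  rewrite ler_wpM2r ?(ltW h0)// ler_wpM2r ?(ltW h0)// -/N.
  by rewrite /K; lra.
have J0 := concave_cost_ge0 n0 : forall S : {set 'I_n * V}, 0 <= J S.
have J1 := concave_cost_incr n0 : forall (S : {set 'I_n * V}) a, a \notin S -> N * h <= J (a |: S)%SET - J S.
have J2 := concave_cost_diff2 n0 : forall (S : {set 'I_n * V}) a b, a \notin S -> b \notin S -> a != b ->
  J (a |: (b |: S))%SET - J (a |: S)%SET - J (b |: S)%SET + J S <= - (h * h).
pose F s := interp (Fm s) G (asym s) J del Lam eps.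
have F_ms s : monotone_submodular (F s).
  exact: (interp_monotone_submodular (Fm_ms s) G_ms h0 del0 N1 del_le K1 (ltW eps0)
    (asym_bnd n0 s) (H_bnd s) (H_lip s) (D_lip s) (D_diff2 s) J0 J1 J2 h_small Lam_def
    Lam0 Lam_big).
exists (fun S => G S + eps * J S), F; split=> //.
(* [g] is the degenerate interpolation from [G] to itself, so the same lemma applies to it. *)
- have -> : (fun S => G S + eps * J S) = interp G G (fun=> 0) J del Lam eps.
    by apply/funext => S; rewrite /interp subrr mulr0 addr0.
  have hhr (r : R) : 0 <= r -> 0 <= K * h * (r + h).
    by move=> r0; apply: mulr_ge0; [apply: mulr_ge0 | apply: addr_ge0] => //; exact: ltW.
  apply: (interp_monotone_submodular G_ms G_ms h0 del0 N1 del_le K1 (ltW eps0)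
    _ _ _ _ _ J0 J1 J2 h_small Lam_def Lam0 Lam_big).
  + by rewrite lexx ltW.
  + by move=> S; rewrite subrr normr0 mulr0.
  + by move=> S a r _ r0 _; rewrite !subrr normr0; exact: hhr.
  + by move=> S a r _ r0 _; rewrite subrr normr0; exact: hhr.
  + by move=> *; rewrite !subrr addr0 normr0; do !apply: mulr_ge0; exact: ltW.
- by move=> S; rewrite lerDl mulr_ge0// ltW.
- move=> s S; have := interp_close J eps del0 del_le K1 (asym_bnd n0 s) (H_bnd s) Lam_def Lam0 S.
  have hJ : eps * J S <= eta / 2.
    have := concave_cost_le n0 S; rewrite -/(J S) -/N => hJ.
    apply: le_trans (ler_wpM2l (ltW eps0) hJ) _.
    rewrite le_eqVlt; apply/orP; left; apply/eqP; rewrite /eps.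
    by field; rewrite gt_eqF.
  by rewrite ler_norml -/(F s S) -/(Fm s S) => /andP[_]; lra.
- by move=> s S hS; apply: interp_near.
Qed.

End TwistedGrid.

(** * Optimal values *)

Section OptBounds.
Context {R : realType} {U : finType} {k : nat}.
Implicit Types (f : {set U} -> R) (T P : 'I_k -> {set U}).

Lemma inf_cost_le f (Q : {ffun 'I_k -> {set U}} -> Prop) (P : {ffun 'I_k -> {set U}}) :
  (forall A, 0 <= f A) -> Q P ->
  inf [set cost f P' | P' in [set P' : {ffun 'I_k -> {set U}} | Q P']]%classic <= cost f P.
Proof.
move=> f0 hP; apply: ge_inf; last by exists P.
by exists 0 => _ [P' _ <-]; apply: sumr_ge0.
Qed.

Lemma multiway_opt_le f T P : (forall A, 0 <= f A) -> feasible T P ->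
  multiway_opt f T <= cost f P.
Proof.
move=> f0 [[dP cP] tP]; have e i : [ffun i => P i] i = P i by rewrite ffunE.
have -> : cost f P = cost f [ffun i => P i] by apply: eq_bigr => i _; rewrite e.
apply: (inf_cost_le (Q := fun P' : {ffun 'I_k -> {set U}} => feasible T P')) => //.
split; first split.
- by move=> i j ij; rewrite !e; apply: dP.
- by move=> x; have [i xi] := cP x; exists i; rewrite e.
- by move=> i; rewrite e.
Qed.

Lemma multiway_opt_adherent f T P (eta : R) : (forall A, 0 <= f A) -> feasible T P ->
  0 < eta -> exists2 P', feasible T P' & cost f P' < multiway_opt f T + eta.
Proof.
move=> f0 [[dP cP] tP] eta0; have e i : [ffun i => P i] i = P i by rewrite ffunE.
pose E := [set cost f P' | P' in [set P' : {ffun 'I_k -> {set U}} | feasible T P']]%classic.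
have hE : has_inf E.
  split; last by exists 0 => _ [P' _ <-]; apply: sumr_ge0.
  exists (cost f [ffun i => P i]); exists [ffun i => P i] => //; split; first split.
  - by move=> i j ij; rewrite !e; apply: dP.
  - by move=> x; have [i xi] := cP x; exists i; rewrite e.
  - by move=> i; rewrite e.
have [_ [P' hP' <-] lt] := inf_adherent eta0 hE.
by exists P'.
Qed.

Lemma multiway_opt_ge0 f T : (forall A, 0 <= f A) -> 0 <= multiway_opt f T.
Proof.
move=> f0; rewrite /multiway_opt; set E := (X in inf X).
have [->|/set0P E0] := eqVneq E classical_sets.set0; first by rewrite inf0.
by apply: lb_le_inf => // _ [P' _ <-]; apply: sumr_ge0.
Qed.

End OptBounds.

(** * Rounding partitions of the blow-up to the grid, and lifting them back *)

Section Rounding.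
Context {R : realType} {k n : nat}.
Notation V := ('I_k * 'I_k)%type.
Notation W := ('I_n * ('I_k * 'I_k))%type.
Notation Theta := {ffun 'I_k * 'I_k -> 'I_n * bool}.

(** All copies of a diagonal point. Every twist fixes them, so the terminals reveal nothing about
    the secret string. *)
Definition blowup_terminals (l : 'I_k) : {set W} := [set w | w.2 == (l, l)]%SET.

(** A canonical element of the pair [{v, swap v}]; sampling at it makes both points share one random
    choice. *)
Definition orbit_repr (v : V) : V := if (v.1 <= v.2)%N then v else swap v.

Lemma orbit_repr_swap v : orbit_repr (swap v) = orbit_repr v.
Proof.
case: v => i j; rewrite /orbit_repr /swap /=.
by case: ltngtP => // e; congr (_, _); apply: val_inj.
Qed.

Lemma orbit_repr_diag (i : 'I_k) : orbit_repr (i, i) = (i, i).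
Proof. by rewrite /orbit_repr leqnn. Qed.

(* On a set Z where orbit_repr agrees with an involution of V made of swaps,
   the symmetric rounding is the independent rounding up to relabelling theta. *)
Lemma sum_sym_rounding_on (g : {set V} -> R) (S : {set W}) (Z : {set V}) (c : V -> bool) :
  (forall v, c (swap v) = c v) -> (forall v, v \in Z -> orbit_repr v = twist (c v) v) ->
  \sum_(th : Theta) g ([set v | point_sym v (th v) \in S] :&: Z)%SET =
  \sum_(th : Theta)
     g ([set v | point_sym (orbit_repr v) (th (orbit_repr v)) \in S] :&: Z)%SET.
Proof.
move=> c_swap hZ; pose pi v := twist (c v) v.
have c_pi v : c (pi v) = c v by rewrite /pi; case e: (c v) => //=; rewrite c_swap.
have piK v : pi (pi v) = v by rewrite {1}/pi c_pi twistK.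
(* The sample of [pi v] moves to [v], with its coin flipped when [pi] swaps [v]; then [point_sym]
   yields at [v] the point it yielded at [pi v]. *)
pose relabel (th : Theta) : Theta :=
  [ffun v => ((th (pi v)).1, (th (pi v)).2 (+) c v)].
have relabelK : involutive relabel.
  move=> th; apply/ffunP => v; rewrite !ffunE /= piK c_pi -addbA addbb addbF.
  by case: (th v).
rewrite (reindex_inj (can_inj relabelK)); apply: eq_bigr => th _; congr g.
apply/finset.setP => v; rewrite !inE; case vZ: (v \in Z); rewrite ?andbF// !andbT.
rewrite hZ// /point_sym ffunE /= twist_twist.
by rewrite -/(pi v).
Qed.

Lemma sum_sym_rounding (f : {set V} -> R) (S : {set W}) : row_column_type f ->
  \sum_(th : Theta) f [set v | point_sym v (th v) \in S]%SET =
  \sum_(th : Theta)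
     f [set v | point_sym (orbit_repr v) (th (orbit_repr v)) \in S]%SET.
Proof.
case=> g [_ _ fE]; under eq_bigr do rewrite fE; under [RHS]eq_bigr do rewrite fE.
rewrite exchange_big [RHS]exchange_big /=; apply: eq_bigr => i _.
rewrite !big_split /=; congr (_ + _).
(* The representative differs from [v] for the entries of row [i] left of the diagonal; adding their
   mirror images makes [c] invariant under [swap]. Column [i] below is treated alike, with the
   entries under the diagonal. *)
- pose c (v : V) := (v.1 == i) && (v.2 < i)%N || (v.2 == i) && (v.1 < i)%N.
  apply: (@sum_sym_rounding_on g S _ c); rewrite /c.
    by move=> v; rewrite orbC.
  case=> a b; rewrite inE /orbit_repr /= => /eqP ->; rewrite eqxx /=.
  by rewrite ltnn andbF orbF; case: ltnP.
- pose c (v : V) := (v.2 == i) && (i < v.1)%N || (v.1 == i) && (i < v.2)%N.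
  apply: (@sum_sym_rounding_on g S _ c); rewrite /c.
    by move=> v; rewrite orbC.
  case=> a b; rewrite inE /orbit_repr /= => /eqP ->; rewrite eqxx /=.
  by rewrite ltnn andbF orbF; case: ltnP.
Qed.

(** After the passage to shared choices, every outcome [th], used for all parts at once, rounds [P]
    to a symmetric feasible partition. Each outcome thus costs at least [OPT_Sym f], and so does the
    mean. *)
Lemma OPT_Sym_le_mean (f : {set V} -> R) (P : 'I_k -> {set W}) : (0 < n)%N ->
  (forall A, 0 <= f A) -> row_column_type f -> feasible blowup_terminals P ->
  OPT_Sym f <= \sum_(l < k) sample_mean f point_sym (P l).
Proof.
move=> n0 f0 f_rc [[dP cP] tP].
have T0 : 0 < #|{: Theta}|%:R :> R.
  rewrite ltr0n card_ffun expn_gt0 card_prod card_ord card_bool.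
  by rewrite muln_gt0 n0.
rewrite /sample_mean -mulr_sumr ler_pdivlMl//.
under eq_bigr do rewrite sum_sym_rounding//.
rewrite exchange_big /= mulr_natl -sumr_const; apply: ler_sum => th _.
pose A : {ffun 'I_k -> {set V}} :=
  [ffun l => [set v | point_sym (orbit_repr v) (th (orbit_repr v)) \in P l]%SET].
have -> : \sum_(l < k) f [set v | point_sym (orbit_repr v) (th (orbit_repr v)) \in P l]%SET
   = cost f A by apply: eq_bigr => l _; rewrite ffunE.
apply: (inf_cost_le (Q := fun P' : {ffun 'I_k -> {set V}} =>
  feasible diag_terminals P' /\ symmetric_family P')) => //.
split; first split; first split.
- move=> i j ij; apply/finset.setP => v; rewrite !ffunE !inE.
  by have /finset.setP/(_ (point_sym (orbit_repr v) (th (orbit_repr v)))) := dP i j ij; rewrite !inE.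
- move=> v; have [i hi] := cP (point_sym (orbit_repr v) (th (orbit_repr v))).
  by exists i; rewrite ffunE inE.
- move=> l; rewrite finset.sub1set ffunE inE; apply: (fintype.subsetP (tP l)).
  by rewrite inE /point_sym orbit_repr_diag twist_diag.
- move=> l; apply/finset.setP => v; rewrite /transpose !ffunE !inE.
  by rewrite -[(v.2, v.1)]/(swap v) orbit_repr_swap.
Qed.

Definition twisted_partition (s : {ffun 'I_n -> bool}) (P : 'I_k -> {set V}) (l : 'I_k) : {set W} :=
  [set w | twist (s w.1) w.2 \in P l]%SET.

Lemma twisted_partition_feasible s (P : 'I_k -> {set V}) :
  feasible diag_terminals P -> feasible blowup_terminals (twisted_partition s P).
Proof.
move=> [[dP cP] tP]; split; first split.
- move=> i j ij; apply/finset.setP => w; rewrite !inE.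
  by have /finset.setP/(_ (twist (s w.1) w.2)) := dP i j ij; rewrite !inE.
- by move=> w; have [i hi] := cP (twist (s w.1) w.2); exists i; rewrite inE.
- move=> l; apply/fintype.subsetP => w; rewrite !inE => /eqP ->.
  by rewrite twist_diag; apply: (fintype.subsetP (tP l)); rewrite inE.
Qed.

(** The sampling by [s] undoes the twist by [s], so every sample recovers exactly [P l]. *)
Lemma twisted_partition_mean (f : {set V} -> R) s (P : 'I_k -> {set V}) l : (0 < n)%N ->
  sample_mean f (point_twisted s) (twisted_partition s P l) = f (P l).
Proof.
move=> n0; rewrite /sample_mean.
under eq_bigr => th _.
  have -> : [set v | point_twisted s v (th v) \in twisted_partition s P l]%SET = P l.
    by apply/finset.setP => v; rewrite !inE /= twistK.
  over.
rewrite sumr_const -[f (P l) *+ _]mulr_natl mulKf// pnatr_eq0 -lt0n.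
by rewrite card_ffun expn_gt0 card_prod card_ord card_bool muln_gt0 n0.
Qed.

Lemma diag_feasible : (0 < k)%N -> exists P : 'I_k -> {set V}, feasible diag_terminals P.
Proof.
move=> k0; pose own (v : V) := if v.1 == v.2 then v.1 else Ordinal k0.
exists (fun l => [set v | own v == l]%SET); split; first split.
- move=> i j ij; apply/finset.setP => v; rewrite !inE.
  by case: eqVneq => //= ->; apply/negbTE.
- by move=> v; exists (own v); rewrite inE.
- by move=> l; rewrite finset.sub1set inE /own eqxx.
Qed.

Lemma blowup_terminals_disjoint : pairwise_disjoint blowup_terminals.
Proof.
move=> i j ij; apply/finset.setP => w; rewrite !inE.
by case: eqVneq => //= ->; rewrite xpair_eqE (negbTE ij).
Qed.

End Rounding.

(** * Algorithms against random twists *)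

Section OracleRuns.
Context {R : realType} {U : finType} {O : Type}.
Implicit Types (a : oracle_alg R U O) (h : {set U} -> R).

Fixpoint queries a h : seq {set U} :=
  match a with
  | Output _ => [::]
  | Query A next => A :: queries (next (h A)) h
  end.

Lemma size_queries a h : size (queries a h) = num_queries a h.
Proof. by elim: a => //= A next IH; rewrite IH. Qed.

(** Equal answers to the queries asked under [h] keep the algorithm on the same branch. *)
Lemma run_agree a h h' : {in queries a h, h =1 h'} -> run a h' = run a h.
Proof.
elim: a => //= A next IH hh.
rewrite -(hh A) ?mem_head//; apply: IH => B hB; apply: hh.
by rewrite inE hB orbT.
Qed.

End OracleRuns.

(** * A Chernoff bound for random signs *)

Section Concentration.
Context {R : realType}.

(** A bound on the hyperbolic cosine from [expR y <= 1 / (1 - y)] alone: the sum is at most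
    [2 / (1 - x ^+ 2)], and [1 / (1 - u) <= 1 + 3 / 2 * u] for [0 <= u <= 1 / 3]. *)
Lemma expR_add_oppr_le (x : R) : x ^+ 2 <= 3^-1 ->
  expR x + expR (- x) <= 2 * expR (3 / 2 * x ^+ 2).
Proof.
move=> hx.
have x1 : `|x| < 1.
  rewrite -(ltr_pXn2r (isT : (0 < 2)%N)) ?nnegrE// real_normK ?num_real// expr1n.
  lra.
have /andP[l1 l2] : - 1 < x < 1 by rewrite -ltr_norml.
have e (y : R) : y < 1 -> expR y <= (1 - y)^-1.
  move=> y1; rewrite -[y]opprK expRN opprK lef_pV2 ?posrE ?expR_gt0 ?subr_gt0//.
  exact: expR_ge1Dx.
have h1 := e x l2; have h2 := e (- x) ltac:(lra).
have h3 : (1 - x)^-1 + (1 - - x)^-1 = 2 / (1 - x ^+ 2).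
  by field; apply/and3P; split; rewrite ?gt_eqF//; nra.
have h4 : 2 / (1 - x ^+ 2) <= 2 * (1 + 3 / 2 * x ^+ 2).
  rewrite ler_pdivrMr; last by lra.
  have := sqr_ge0 x; set u := x ^+ 2 in hx *; nra.
have := expR_ge1Dx (3 / 2 * x ^+ 2).
lra.
Qed.

Lemma chernoff (n : nat) (c : 'I_n -> R) (del : R) :
  (forall i, `|c i| <= 1) -> 0 < del <= 1 ->
  #|[set s : {ffun 'I_n -> bool} |
      del * n%:R < \sum_i (if s i then - c i else c i)]%SET|%:R
  <= 2 ^+ n * expR (- (del ^+ 2 / 6 * n%:R)).
Proof.
(* This value minimizes the exponent [3 / 2 * lam ^+ 2 - lam * del], whose minimum is
   [- del ^+ 2 / 6]. *)
move=> hc /andP[del0 del1]; pose lam := del / 3.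
pose X (s : {ffun 'I_n -> bool}) := \sum_i (if s i then - c i else c i).
have lam0 : 0 < lam by rewrite divr_gt0.
have hsum : \sum_(s : {ffun 'I_n -> bool}) expR (lam * X s) <=
    2 ^+ n * expR (del ^+ 2 / 6 * n%:R).
  have -> : \sum_(s : {ffun 'I_n -> bool}) expR (lam * X s) =
     \prod_(i < n) \sum_(b : bool) expR (lam * (if b then - c i else c i)).
    rewrite bigA_distr_bigA /=; apply: eq_bigr => s _.
    by rewrite /X mulr_sumr expR_sum.
  have -> : 2 ^+ n * expR (del ^+ 2 / 6 * n%:R) =
      \prod_(i < n) (2 * expR (del ^+ 2 / 6)).
    by rewrite prodr_const card_ord exprMn expRM_natr.
  apply: ler_prod => i _; rewrite big_bool /= addr_ge0 ?expR_ge0//=.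
  rewrite addrC mulrN.
  have l2 : (lam * c i) ^+ 2 <= lam ^+ 2.
    rewrite exprMn ler_piMr ?sqr_ge0// -real_normK ?num_real//.
    by rewrite exprn_ile1.
  have l3 : lam ^+ 2 = del ^+ 2 / 9 by rewrite /lam; field.
  have d2 : del ^+ 2 <= 1 by rewrite exprn_ile1// ltW.
  apply: le_trans (expR_add_oppr_le (_ : _ <= 3^-1)) _; first lra.
  by rewrite ler_pM2l// ler_expR; lra.
have hM : #|[set s : {ffun 'I_n -> bool} | del * n%:R < X s]%SET|%:R *
    expR (lam * (del * n%:R)) <= \sum_(s : {ffun 'I_n -> bool}) expR (lam * X s).
  rewrite mulr_natl -sumr_const big_mkcond /=; apply: ler_sum => s _.
  rewrite inE; case: ifP => hs; last exact: expR_ge0.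
  by rewrite ler_expR ler_pM2l// ltW.
have := le_trans hM hsum; rewrite -ler_pdivlMr ?expR_gt0// -expRN -[2 ^+ n * _ * _]mulrA -expRD => h.
apply: le_trans h _; rewrite le_eqVlt; apply/orP; left; apply/eqP.
by congr (_ * expR _); rewrite /lam; field.
Qed.

End Concentration.

(** * Few twists make a given set unbalanced *)

Section Balanced.
Context {R : realType} {k : nat}.
Notation V := ('I_k * 'I_k)%type.

Lemma unbalanced_card (del : R) : 0 < del ->
  exists2 c : R, 0 < c & forall n (S : {set 'I_n * V}), (0 < n)%N ->
   #|[set s : {ffun 'I_n -> bool} | ~~ (asym s S <= del)]%SET|%:R <=
   2 * #|{: V}|%:R * (2 ^+ n * expR (- (c * n%:R))).
Proof.
move=> del0; pose N : R := #|{: V}|%:R.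
have N0 : 0 <= N by rewrite ler0n.
(* Bounding all coordinates by [d] gives [asym] at most [N * d ^+ 2 <= del]; the cap at 1 is
   required by [chernoff]. *)
pose d := Num.min 1 (del / (N + 1)).
have d0 : 0 < d by rewrite lt_min ltr01 divr_gt0// ltr_wpDl.
have d1 : d <= 1 by rewrite ge_min lexx.
have dN : N * d ^+ 2 <= del.
  have h1 : d * (N + 1) <= del by rewrite -ler_pdivlMr ?ltr_wpDl// ge_min lexx orbT.
  have h2 : d ^+ 2 <= d by rewrite expr2 ler_piMl// ltW.
  have h3 : N * d ^+ 2 <= N * d by rewrite ler_wpM2l.
  have h4 : N * d = d * (N + 1) - d by ring.
  lra.
exists (d ^+ 2 / 6); first by rewrite divr_gt0// exprn_gt0.
move=> n S n0; have nR0 : 0 < n%:R :> R by rewrite ltr0n.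
pose c (v : V) (i : 'I_n) : R := ((i, v) \in S)%:R - ((i, swap v) \in S)%:R.
pose X (v : V) (s : {ffun 'I_n -> bool}) := \sum_i (if s i then - c v i else c v i).
pose B (v : V) := [set s : {ffun 'I_n -> bool} | d * n%:R < X v s]%SET.
have XE v s : X v s = n%:R * (2 * antipart swap (density s S) v).
  have -> : 2 * antipart swap (density s S) v = density s S v - density s S (swap v) :> R.
    by rewrite /antipart; field.
  rewrite /density -mulrBr mulVKf ?gt_eqF// -sumrB; apply: eq_bigr => i _.
  by rewrite twist_swap /c; case: (s i) => //=; ring.
(* The lower tail at [v] is the upper tail at [swap v], so one-sided bounds over all [v] suffice. *)
have Xswap v s : X (swap v) s = - X v s.
  by rewrite !XE /antipart swapK; ring.
have hB v : #|B v|%:R <= 2 ^+ n * expR (- (d ^+ 2 / 6 * n%:R)).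
  apply: chernoff; last by rewrite d0.
  have b01 (b : bool) : 0 <= (b%:R : R) <= 1 by case: b; rewrite ?ler01 ?lexx.
  move=> i; rewrite /c; have /andP[? ?] := b01 ((i, v) \in S).
  have /andP[? ?] := b01 ((i, swap v) \in S).
  by rewrite ler_norml; apply/andP; split; lra.
have sub : [set s : {ffun 'I_n -> bool} | ~~ (asym s S <= del)]%SET \subset
    (\bigcup_(v : V) B v)%SET.
  apply/fintype.subsetP => s; rewrite inE; apply: contraNT => hs.
  have hv v : X v s <= d * n%:R.
    rewrite leNgt; apply: contraNN hs => hv; apply/finset.bigcupP.
    by exists v => //; rewrite inE.
  apply: le_trans dN; rewrite /asym.
  apply: (@le_trans _ _ (\sum_(v : V) d ^+ 2)); last by rewrite sumr_const -[leLHS]mulr_natl.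
  apply: ler_sum => v _; rewrite -real_normK ?num_real//.
  rewrite lerXn2r ?nnegrE ?(ltW d0)//.
  have := hv v; have := hv (swap v); rewrite Xswap XE.
  rewrite -mulrN mulrC ler_pM2r// => b1; rewrite mulrC ler_pM2r// => b2.
  by rewrite ler_norml; apply/andP; split; lra.
apply: (@le_trans _ _ (\sum_(v : V) #|B v|%:R)).
  rewrite -natr_sum ler_nat; apply: leq_trans (subset_leq_card sub) _.
  apply: (big_ind2 (fun (A : {set _}) m => (#|A| <= m)%N)) => [|A a A' a' h1 h2|v _] //.
    by rewrite cards0.
  by apply: leq_trans (leq_card_setU _ _) _; exact: leq_add.
apply: (@le_trans _ _ (\sum_(v : V) 2 ^+ n * expR (- (d ^+ 2 / 6 * n%:R)))).
  exact: ler_sum.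
rewrite sumr_const -[leLHS]mulr_natl -/N ler_wpM2r//.
by rewrite mulr_natl mulr2n lerDl.
Qed.

End Balanced.

(** * Averaging over instances against the randomness of the algorithm *)

Section Averaging.
Context {R : realType} {d : measure_display} {Omega : measurableType d}.
Local Open Scope classical_set_scope.

(** The expected number of events that occur is at least [#|I| * p] by linearity and at most [M]
    pointwise. With [I] the set of twists, a randomized algorithm is thereby judged seed by seed. *)
Lemma averaging (Pr : probability Omega R) (I : finType) (E : I -> set Omega) (p M : R) :
  (forall i, measurable (E i)) -> (forall i, (p%:E <= Pr (E i))%E) ->
  (forall w, #|[set i | `[< E i w >]]%SET|%:R <= M) ->
  #|I|%:R * p <= M.
Proof.
move=> mE hp hM.
have mf i : measurable_fun setT (EFin \o (\1_(E i) : Omega -> R)).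
  by apply/measurable_EFinP; exact: measurable_indic.
have h1 : ((#|I|%:R * p)%:E <= \sum_(i : I) Pr (E i))%E.
  rewrite mulr_natl -sumr_const -sumEFin; apply: lee_sum => i _; exact: hp.
have h2 : (\sum_(i : I) Pr (E i) = \int[Pr]_w (\sum_(i : I) (\1_(E i) w)%:E))%E.
  rewrite ge0_integral_sum//; apply: eq_bigr => i _.
  by rewrite integral_indic// setIT.
have h3 : (\int[Pr]_w (\sum_(i : I) (\1_(E i) w)%:E) <= \int[Pr]_w (cst M%:E w))%E.
  apply: ge0_le_integral => //.
  - by move=> w _; apply: sume_ge0 => i _; rewrite lee_fin.
  - exact: emeasurable_sum.
  - move=> w _; rewrite sumEFin lee_fin; apply: le_trans (hM w).
    rewrite -sum1_card natr_sum [leRHS]big_mkcond /=; apply: ler_sum => i _.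
    by rewrite indicE inE; case: asboolP => h; [rewrite mem_set | rewrite memNset].
by rewrite -lee_fin; apply: le_trans h1 _; rewrite h2; apply: le_trans h3 _;
  rewrite integral_cst// [X in (_ * X)%E]probability_setT mule1.
Qed.

Lemma success_measurable {U : finType} {k : nat}
    (alg : Omega -> oracle_alg R U {ffun 'I_k -> {set U}}) (h : {set U} -> R)
    (Q : {ffun 'I_k -> {set U}} -> Prop) :
  (forall o, measurable [set w | run (alg w) h = o]) ->
  measurable [set w | Q (run (alg w) h)].
Proof.
move=> mo; have -> : [set w | Q (run (alg w) h)] =
    \bigcup_(o in [set o | Q o]) [set w | run (alg w) h = o].
  apply/seteqP; split=> w /=; last by case=> o ho ->.
  by exists (run (alg w) h).
by apply: fin_bigcup_measurable => //; exact: finite_finset.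
Qed.

End Averaging.

Theorem theorem2p5 (R : realType) (k : nat) (k_gt0 : (0 < k)%N)
    (f : {set 'I_k * 'I_k} -> R)
    (f_ms : monotone_submodular f) (f_rc : row_column_type f)
    (gamma p : R) (gamma_gt0 : 0 < gamma) (p_gt0 : 0 < p) :
  exists c : R, 0 < c /\
  exists n0 : nat, forall n : nat, (n0 <= n)%N ->
  exists (fhat : {set 'I_n * ('I_k * 'I_k)} -> R)
         (T : 'I_k -> {set 'I_n * ('I_k * 'I_k)}),
    [/\ monotone_submodular fhat,
        pairwise_disjoint T &
        forall (d : measure_display) (Omega : measurableType d)
               (Pr : probability Omega R)
               (alg : Omega -> oracle_alg R ('I_n * ('I_k * 'I_k))%type
                                 {ffun 'I_k -> {set 'I_n * ('I_k * 'I_k)}}),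
          achieves_factor Pr alg T (SymGap f - gamma) p ->
          exists w : Omega,
            2 `^ (c * n%:R) <= (num_queries (alg w) fhat)%:R].
Proof.
have [f_ge0 _ _] := f_ms; have kR0 : 0 < k%:R :> R by rewrite ltr0n.
set alpha := SymGap f - gamma.
have [alpha_lt1|alpha_ge1] := ltP alpha 1.
  (* No algorithm succeeds on the constant oracle 1. This covers OPT f = 0. *)
  exists 1; split=> //; exists 0%N => n _.
  exists (fun=> 1), blowup_terminals; split.
  - exact: monotone_submodular_cst.
  - exact: blowup_terminals_disjoint.
  - move=> d Omega Pr alg /(_ (fun=> 1) (monotone_submodular_cst ler01))[_].
    set E := (X in Pr X); have -> : E = classical_sets.set0.
      rewrite -subset0 => w [hP]; set P := run _ _ in hP *.
      have := multiway_opt_le (f := fun=> 1 : R) (fun=> ler01) hP.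
      have := multiway_opt_ge0 (@blowup_terminals k n) (f := fun=> 1 : R) (fun=> ler01).
      rewrite /cost sumr_const card_ord; set o := multiway_opt _ _ => o0 ok.
      rewrite leNgt => /negP; apply.
      have [a0|a0] := leP 0 alpha.
        apply: le_lt_trans (ler_wpM2l a0 ok) _.
        by rewrite gtr_pMl.
      by apply: le_lt_trans _ kR0; rewrite nmulr_rle0.
    by rewrite measure0 lee_fin leNgt p_gt0.
have opt_ge0 : 0 <= OPT f by exact: multiway_opt_ge0.
(* If [OPT f] were 0, the convention for division by 0 would make [alpha] equal to [- gamma], which
   is below 1. *)
have opt_gt0 : 0 < OPT f.
  rewrite lt_neqAle opt_ge0 andbT; apply: contraTneq alpha_ge1 => e.
  by rewrite -ltNge /alpha /SymGap -e invr0 mulr0; lra.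
have alpha_gt0 : 0 < alpha by exact: lt_le_trans alpha_ge1.
(* The gap [gamma * OPT f] is split into [k + 1] errors: one for each part, from the passage to
   [F s], and one for a merely near-optimal partition of the grid. *)
pose eta := gamma * OPT f / (alpha * (k%:R + 1)).
have k1 : 0 < k%:R + 1 :> R by rewrite addr_gt0.
have eta_gt0 : 0 < eta by rewrite divr_gt0// mulr_gt0.
have opt_gap : alpha * (OPT f + (k%:R + 1) * eta) = OPT_Sym f.
  have e : alpha * OPT f = OPT_Sym f - gamma * OPT f.
    by rewrite /alpha mulrBl divfK// gt_eqF.
  have -> : OPT_Sym f = alpha * OPT f + gamma * OPT f by rewrite e subrK.
  rewrite /eta; move: (OPT f) (alpha) alpha_gt0 => o a a_gt0.
  by field; rewrite !gt_eqF.
have [del del_gt0 [n1 family]] := hard_family k_gt0 f_ms f_rc eta_gt0.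
have [c c_gt0 unbalanced] := @unbalanced_card R k del del_gt0.
pose N : R := #|{: 'I_k * 'I_k}|%:R.
have N_ge0 : 0 <= N by rewrite ler0n.
(* Half of the exponential decay rate pays for the number of queries, the other half remains to beat
   [p]. *)
exists (c / 2); split; first by rewrite divr_gt0.
(* For [n >= m] the bound [expR y >= 1 + y] already yields [tail]. *)
pose m : R := (k%:R + 1) * (2 * N) / p / (c / 2).
have m_ge0 : 0 <= m.
  by rewrite /m !divr_ge0 ?mulr_ge0 ?(ltW k1) ?(ltW p_gt0) ?(ltW c_gt0).
exists (maxn n1 (Num.bound m)) => n; rewrite geq_max => /andP[hn1 hn2].
have [n_gt0 [g [F [g_ms F_ms g_ge F_le Fg]]]] := family n hn1.
exists g, blowup_terminals; split=> //; first exact: blowup_terminals_disjoint.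
move=> d Omega Pr alg alg_ok; apply: contrapT => /forallNP few.
pose y := c / 2 * n%:R.
have y_gt0 : 0 < y by rewrite mulr_gt0 ?divr_gt0 ?ltr0n.
have tail : (k%:R + 1) * (2 * N) * expR (- y) < p.
  have hm : (k%:R + 1) * (2 * N) / p < y.
    rewrite /y [c / 2 * _]mulrC -ltr_pdivrMr ?divr_gt0//.
    by apply: lt_le_trans (archi_boundP m_ge0) _; rewrite ler_nat.
  rewrite expRN ltr_pdivrMr ?expR_gt0//.
  rewrite ltr_pdivrMr// in hm.
  apply: lt_le_trans hm _; rewrite mulrC ler_pM2l//.
  by apply: le_trans (expR_ge1Dx y); rewrite lerDr.
(* Base 2 is replaced by base e, since [ln 2 <= 1]. *)
have few_le w : (num_queries (alg w) g)%:R <= expR y.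
  have /negP := few w; rewrite -ltNge => /ltW h; apply: le_trans h _.
  rewrite /powR pnatr_eq0/= ler_expR ler_piMr ?(ltW y_gt0)//.
  by apply: le_trans (ln_le_sub1 _) _ => //; lra.
pose E s := [set w | feasible blowup_terminals (run (alg w) (F s)) /\
  (cost (F s) (run (alg w) (F s)) <= alpha * multiway_opt (F s) blowup_terminals)%R]%classic.
have mE s : measurable (E s).
  have [mo _] := alg_ok (F s) (F_ms s).
  exact: (success_measurable (fun P : {ffun _ -> _} => feasible blowup_terminals P /\
    (cost (F s) P <= alpha * multiway_opt (F s) blowup_terminals)%R) mo).
have opt_F s : alpha * multiway_opt (F s) blowup_terminals < OPT_Sym f.
  have [P0 P0_ok] := @diag_feasible k k_gt0.
  have [P P_ok P_lt] := multiway_opt_adherent f_ge0 P0_ok eta_gt0.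
  have [Fs_ge0 _ _] := F_ms s.
  rewrite -opt_gap ltr_pM2l//.
  apply: le_lt_trans (multiway_opt_le Fs_ge0 (twisted_partition_feasible s P_ok)) _.
  have h : cost (F s) (twisted_partition s P) <= cost f P + k%:R * eta.
    rewrite mulr_natl -[k in _ *+ k]card_ord -sumr_const -big_split /=.
    by apply: ler_sum => l _; rewrite -(twisted_partition_mean f s P l n_gt0).
  apply: le_lt_trans h _; rewrite mulrDl mul1r.
  by rewrite -/(OPT f) in P_lt; lra.
have count w : #|[set s | `[< E s w >]]%SET|%:R <=
    (2 ^+ n * expR (- y)) * ((k%:R + 1) * (2 * N)).
  pose P := run (alg w) g.
  (* The parts of the output join the queries: their cost too must be the same under [F s] as under
     [g]. *)
  pose Q := queries (alg w) g ++ [seq P l | l <- enum 'I_k].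
  have sizeQ : (size Q)%:R <= (k%:R + 1) * expR y.
    rewrite size_cat size_map -cardE card_ord size_queries natrD mulrDl mul1r.
    rewrite addrC lerD// ler_peMr// -expR0 ler_expR ltW//.
  have sub : [set s | `[< E s w >]]%SET \subset
      (\bigcup_(A <- Q) [set s : {ffun 'I_n -> bool} | ~~ (asym s A <= del)])%SET.
    apply/fintype.subsetP => s; rewrite inE => /asboolP hE.
    apply: contrapT => /negP hs.
    have bal A : A \in Q -> F s A = g A.
      move=> AQ; apply: Fg; apply: contraNT hs => hA.
      by rewrite (big_rem A)//= !inE hA.
    have runE : run (alg w) (F s) = P.
      apply: run_agree => A hA; rewrite bal// mem_cat hA//.
    move: hE; rewrite /E /= runE => -[P_ok].
    (* If all of [Q] is balanced for [s], the output is that under [g] and costs at least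
       [OPT_Sym f], more than [alpha] times the optimum of [F s]. *)
    apply/negP; rewrite -ltNge; apply: lt_le_trans (opt_F s) _.
    apply: le_trans (OPT_Sym_le_mean n_gt0 f_ge0 f_rc P_ok) _.
    apply: ler_sum => l _; rewrite bal//.
    by rewrite mem_cat map_f ?orbT// mem_enum.
  apply: (@le_trans _ _ ((size Q)%:R * (2 * N * (2 ^+ n * expR (- (c * n%:R)))))).
    apply: (@le_trans _ _ (\sum_(A <- Q) #|[set s : {ffun 'I_n -> bool} | ~~ (asym s A <= del)]%SET|%:R)).
      rewrite -natr_sum ler_nat; apply: leq_trans (subset_leq_card sub) _.
      apply: (big_ind2 (fun (A : {set _}) m => (#|A| <= m)%N)) => [|A a A' a' h1 h2|v _] //.
        by rewrite cards0.
      by apply: leq_trans (leq_card_setU _ _) _; exact: leq_add.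
    rewrite -[size Q]sum1_size natr_sum mulr_suml.
    by apply: ler_sum => A _; rewrite mul1r; exact: unbalanced.
  (* One factor [expR (- y)] cancels the bound on the size of [Q]. *)
  have e : expR (- (c * n%:R)) = expR (- y) * expR (- y).
    by rewrite -expRD; congr expR; rewrite /y; field.
  rewrite e.
  apply: le_trans (ler_wpM2r _ sizeQ) _.
    by rewrite !mulr_ge0 ?exprn_ge0 ?expR_ge0.
  rewrite le_eqVlt; apply/orP; left; apply/eqP.
  rewrite expRN; field; by rewrite gt_eqF// expR_gt0.
have := averaging mE (fun s => (alg_ok (F s) (F_ms s)).2) count.
rewrite card_ffun card_bool card_ord natrX -mulrA ler_pM2l ?exprn_gt0//.
by rewrite leNgt mulrC tail.
Qed.
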